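(* Let $\mathcal P$ be a quotient operad of $\mathcal{A}ss$ over the field $\Bbbk$ and let $n=\operatorname{GKdim}\mathcal P$. Let ${}^k\Upsilon$ be the truncations of $\mathcal{A}ss$. (1) If $n=1$, then $\mathcal P=\mathcal{A}ss/{}^1\Upsilon\cong\mathcal{C}om$. (2) $\operatorname{GKdim}\mathcal P$ cannot be $2$ (so it cannot be strictly between $1$ and $3$). (3) If $n=3$, then $\mathcal P=\mathcal{A}ss/{}^3\Upsilon$. (4) If $n=4$, then $\mathcal P=\mathcal{A}ss/{}^4\Upsilon$. (5) There are at least two non-isomorphic quotient operads $\mathcal P$ of $\mathcal{A}ss$ such that $\operatorname{GKdim}\mathcal P=5$.
   Context: Fix a base field $\Bbbk$; all operads are $\Bbbk$-linear symmetric operads (right $\mathbb S_n$-action on $\mathcal P(n)$, identity $\mathbf 1=\mathbf 1_1\in\mathcal P(1)$, compositions $\theta\circ(\theta_1,\dots,\theta_n)$ with the usual unit, associativity and equivariance axioms). $\mathcal{A}ss$ is the operad encoding unital associative $\Bbbk$-algebras: $\mathcal{A}ss(n)=\Bbbk\mathbb S_n$ (right regular module) for all $n\ge0$, with composition given by block permutations; $\mathbf 1_0$ is the identity of $\mathbb S_0$. $\mathcal{C}om$ is the operad of unital commutative algebras ($\mathcal{C}om(n)=\Bbbk$ for all $n\ge0$). An operadic ideal $\mathcal I$ of $\mathcal{A}ss$ is a family of $\mathbb S_n$-submodules $\mathcal I(n)\subseteq\mathcal{A}ss(n)$ such that $\theta\circ(\theta_1,\dots,\theta_n)\in\mathcal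 I$ whenever at least one of $\theta,\theta_1,\dots,\theta_n$ is in $\mathcal I$. A quotient operad of $\mathcal{A}ss$ is $\mathcal{A}ss/\mathcal I$ for an operadic ideal $\mathcal I$; the equality $\mathcal{A}ss/\mathcal I=\mathcal{A}ss/{}^k\Upsilon$ means $\mathcal I={}^k\Upsilon$. Truncations: let $[n]=\{1,\dots,n\}$. For $I\subseteq[n]$ with characteristic function $\chi_I$, $\pi^I(\theta)=\theta\circ(\mathbf 1_{\chi_I(1)},\dots,\mathbf 1_{\chi_I(n)})$. For $k\ge1$, ${}^k\Upsilon(n)=\bigcap_{I\subseteq[n],|I|=k-1}\ker(\pi^I:\mathcal{A}ss(n)\to\mathcal{A}ss(k-1))$ if $n\ge k$ and $0$ if $n<k$. Each ${}^k\Upsilon$ is an operadic ideal. $\operatorname{GKdim}\mathcal P=\limsup_{n\to\infty}\log_n\big(\sum_{i=0}^n\dim_\Bbbk\mathcal P(i)\big)$.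
   Formalization: Part (4) is stated and proved only when the characteristic of the field is not 3; over every field of characteristic 3 part (4) is false, since an ideal strictly between the fourth and third truncation ideals also gives a quotient of GK dimension 4. *)

(* Defs.v *)
(* Operads over a field, in the MathComp style.  An operad has finite
   dimensional components (vectType), which is what GKdim needs and which holds
   for Ass, its quotients and Com.
     The product of 'S_n composes from left to right, (s * t) i = t (s i); the
   product "s t" of the usual convention (first t, then s) is (t * s)%g, as in
   operad_actM and Ass_data. *)
From HB Require Import structures.
From mathcomp Require Import all_boot all_order perm all_algebra.
From mathcomp Require Import boolp reals constructive_ereal.
From mathcomp Require Import ereal_normedtype sequences exp.

Set Implicit Arguments.
Unset Strict Implicit.
Unset Printing Implicit Defensive.

Import GRing.Theory VectorInternalTheory.
Local Open Scope ring_scope.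

Section VectorQuotient.
Local Open Scope quotient_scope.
Variables (K : fieldType) (V : vectType K) (U : {vspace V}).

Definition vquot := Quotient.quot (pred_of_vspace U : zmodClosed V).
HB.instance Definition _ := GRing.Zmodule.on vquot.
HB.instance Definition _ := EqQuotient.on vquot.

Definition vquot_pi (x : V) : vquot := \pi_vquot x.

Lemma eq_vquot_pi x y : (vquot_pi x == vquot_pi y) = (x - y \in U).
Proof. by rewrite /vquot_pi eqmodE. Qed.

Lemma vquot_reprK : cancel (@repr _ vquot) vquot_pi.
Proof. exact: reprK. Qed.

Lemma vquot_repr_pi x : repr (vquot_pi x) - x \in U.
Proof. by rewrite -eq_vquot_pi vquot_reprK. Qed.

Lemma vquot_piD : {morph vquot_pi : x y / x + y}.
Proof. by move=> x y; rewrite /vquot_pi !piE. Qed.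

Definition vquot_scale (a : K) (q : vquot) : vquot := vquot_pi (a *: repr q).

Lemma vquot_piZ a x : vquot_pi (a *: x) = vquot_scale a (vquot_pi x).
Proof.
by apply/eqP; rewrite eq_vquot_pi -scalerBr memvZ // -memvN opprB vquot_repr_pi.
Qed.

Fact vquot_scaleA a b q :
  vquot_scale a (vquot_scale b q) = vquot_scale (a * b) q.
Proof. by rewrite -[q]vquot_reprK -!vquot_piZ scalerA. Qed.

Fact vquot_scale1 : left_id 1 vquot_scale.
Proof. by move=> q; rewrite -[q]vquot_reprK -vquot_piZ scale1r. Qed.

Fact vquot_scaleDr : right_distributive vquot_scale +%R.
Proof.
move=> a p q; rewrite -[p]vquot_reprK -[q]vquot_reprK.
by rewrite -vquot_piD -!vquot_piZ scalerDr vquot_piD.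
Qed.

Fact vquot_scaleDl q : {morph vquot_scale^~ q : a b / a + b}.
Proof.
move=> a b; rewrite -[q]vquot_reprK.
by rewrite -!vquot_piZ scalerDl vquot_piD.
Qed.

HB.instance Definition _ := GRing.Zmodule_isLmodule.Build K vquot
  vquot_scaleA vquot_scale1 vquot_scaleDr vquot_scaleDl.

Fact vquot_pi_is_linear : linear vquot_pi.
Proof. by move=> a x y; rewrite vquot_piD vquot_piZ. Qed.
HB.instance Definition _ :=
  GRing.isLinear.Build K V vquot _ vquot_pi vquot_pi_is_linear.

Lemma vquot_pi_eq0 x : (vquot_pi x == 0) = (x \in U).
Proof. by rewrite -(linear0 vquot_pi) eq_vquot_pi subr0. Qed.

Fact vquot_finDim : Vector.axiom (\dim (U^C)%VS) vquot.
Proof.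
have aux (Z : zmodType) (x y p q : Z) : x - p - (y - q) = x - y - (p - q).
  by rewrite !opprD !opprK addrACA.
pose W := subvs_of (U^C)%VS.
pose c : 'Hom(V, W) := (linfun (vsproj (U^C)%VS) \o (\1 - projv U))%VF.
have cE x : vsval (c x) = x - projv U x.
  by rewrite comp_lfunE !lfunE /= vsprojK ?lfun_simp ?memv_projC.
pose f (q : vquot) := v2r (c (repr q)).
have cU x y : x - y \in U -> c x = c y.
  move=> xyU; apply/val_inj/eqP; rewrite /= !cE -subr_eq0.
  have -> : x - projv U x - (y - projv U y) = (x - y) - projv U (x - y).
    rewrite [in RHS]linearB /=; move: (projv U x) (projv U y) => p q.
    by exact: aux.
  by rewrite projv_id // subrr.
have fpi x : f (vquot_pi x) = v2r (c x) by congr v2r; apply/cU/vquot_repr_pi.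
have -> : \dim (U^C)%VS = dim W by [].
exists f.
  move=> a p q; rewrite -[p]vquot_reprK -[q]vquot_reprK -linearP !fpi -linearP.
  by congr v2r; rewrite linearP.
exists (fun r => vquot_pi (vsval (r2v r))) => [q|r].
  apply: etrans (vquot_reprK q); apply/eqP; rewrite /f v2rK eq_vquot_pi cE.
  by rewrite addrAC subrr sub0r memvN memv_proj.
rewrite fpi; apply: (can_inj r2vK); rewrite v2rK; apply: val_inj; rewrite /= cE.
have -> : projv U (vsval (r2v r)) = 0; last by rewrite subr0.
by apply/eqP; rewrite -memv_ker lker_proj subvsP.
Qed.

HB.instance Definition _ := Lmodule_hasFinDim.Build K vquot vquot_finDim.

End VectorQuotient.

Section BlockPermutation.
Variables (n : nat) (m : 'I_n -> nat) (s : 'S_n) (p : forall i, 'S_(m i)).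

(* tagnat.Rank i j is the j-th element of the i-th block of 'I_(\sum_i m i).
   block_perm s p is the block permutation s o (p_1, ..., p_n): it applies p i
   inside the i-th block and moves that block to the s i-th place. *)
Definition block_pos i (j : 'I_(m i)) : nat :=
  (\sum_(i' | (s i' < s i)%N) m i' + p i j)%N.

Fact block_pos_lt i (j : 'I_(m i)) : (block_pos j < \sum_i' m i')%N.
Proof.
rewrite /block_pos [ltnRHS](bigID (fun i' => (s i' < s i)%N)) /= ltn_add2l.
by rewrite (bigD1 i) ?ltnn //= ltn_addr.
Qed.

Definition block_fun (k : 'I_(\sum_i m i)) : 'I_(\sum_i m i) :=
  Ordinal (block_pos_lt (tagnat.sig2 k)).

Lemma block_pos_lexi i i' (j : 'I_(m i)) (j' : 'I_(m i')) :
  (s i < s i')%N -> (block_pos j < block_pos j')%N.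
Proof.
move=> lt_s; rewrite /block_pos ltn_addr //.
rewrite [ltnRHS](bigID (fun i0 => (s i0 < s i)%N)) /=.
have -> : (\sum_(i0 | (s i0 < s i')%N && (s i0 < s i)%N) m i0 =
           \sum_(i0 | (s i0 < s i)%N) m i0)%N.
  by apply: eq_bigl => i0 /=; rewrite andb_idl // => /ltn_trans; apply.
by rewrite ltn_add2l (bigD1 i) ?ltnn ?lt_s //= ltn_addr.
Qed.

Lemma Rank_sig (k : 'I_(\sum_i m i)) :
  {i : 'I_n & {j : 'I_(m i) | k = tagnat.Rank i j}}.
Proof. by exists (tagnat.sig1 k), (tagnat.sig2 k); rewrite tagnat.sig2K. Qed.

Lemma block_fun_Rank i (j : 'I_(m i)) :
  block_fun (tagnat.Rank i j) = block_pos j :> nat.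
Proof.
rewrite /= /tagnat.sig2 /tagnat.sig1 /tagnat.Rank.
by rewrite (tagnat.rankK (Tagged (fun i => 'I_(m i)) j)).
Qed.

Fact block_fun_inj : injective block_fun.
Proof.
move=> k k' /(congr1 (@nat_of_ord _)).
case: (Rank_sig k) => i [j ->]; case: (Rank_sig k') => i' [j' ->].
rewrite !block_fun_Rank; have [lt|lt|/val_inj/perm_inj eq_i] := ltngtP (s i) (s i').
- by move=> E; have := block_pos_lexi j j' lt; rewrite E ltnn.
- by move=> E; have := block_pos_lexi j' j lt; rewrite E ltnn.
by subst i'; rewrite /block_pos => /addnI/val_inj/perm_inj ->.
Qed.

Definition block_perm : 'S_(\sum_i m i) := perm block_fun_inj.

Lemma block_permE i (j : 'I_(m i)) :
  block_perm (tagnat.Rank i j) = block_pos j :> nat.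
Proof. by rewrite permE block_fun_Rank. Qed.

End BlockPermutation.

Lemma sum_perm n (s : 'S_n) (m : 'I_n -> nat) :
  (\sum_i m (s i) = \sum_i m i)%N.
Proof. by rewrite [RHS](reindex_inj (@perm_inj _ s)). Qed.

Lemma big_Rank (R : Type) (idx : R) (op : Monoid.com_law idx) n (m : 'I_n -> nat)
   (Q : pred 'I_(\sum_i m i)) (F : 'I_(\sum_i m i) -> R) :
  \big[op/idx]_(k | Q k) F k =
  \big[op/idx]_i \big[op/idx]_(j : 'I_(m i) | Q (tagnat.Rank i j)) F (tagnat.Rank i j).
Proof.
rewrite sig_big_dep /=; rewrite (reindex (@tagnat.rank n m)) /=; last first.
  exact: onW_bij (tagnat.rank_bij).
by apply: eq_big => [[]|[]].
Qed.

Lemma sum_block_pos n (m : 'I_n -> nat) (s : 'S_n) (p : forall i, 'S_(m i)) 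
  (l : 'I_(\sum_i m i) -> nat) i (j : 'I_(m i)) :
  (\sum_(k | (block_perm s p k < block_pos s p j)%N) l k =
  \sum_(i' | (s i' < s i)%N) \sum_(j' : 'I_(m i')) l (tagnat.Rank i' j')
  + \sum_(j' | (p i j' < p i j)%N) l (tagnat.Rank i j'))%N.
Proof.
rewrite big_Rank [LHS](bigID (fun i' => (s i' < s i)%N)) /=; congr (_ + _)%N.
  apply: eq_bigr => i' lt; apply: eq_bigl => j'.
  by rewrite block_permE block_pos_lexi.
rewrite (bigD1 i) ?ltnn //= [X in (_ + X)%N]big1 ?addn0.
  by apply: eq_bigl => j'; rewrite block_permE /block_pos ltn_add2l.
move=> i' /andP[ge ne]; rewrite big_pred0 // => j'.
rewrite block_permE; apply/negbTE; rewrite -leqNgt ltnW // block_pos_lexi //.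
by rewrite ltn_neqAle leqNgt ge andbT; apply: contraNneq ne => /val_inj/perm_inj ->.
Qed.

Lemma block_pos1 n (m : 'I_n -> nat) i (j : 'I_(m i)) :
  block_pos 1 (fun=> 1%g) j = tagnat.Rank i j.
Proof.
rewrite /block_pos tagnat.RankEsum; congr (_ + _)%N; last by rewrite perm1.
by apply: eq_bigl => i'; rewrite !perm1.
Qed.

Lemma block_perm1 n (m : 'I_n -> nat) :
  block_perm (m := m) 1 (fun=> 1%g) = 1%g.
Proof.
apply/permP => k; case: (Rank_sig k) => i [j ->]; apply: val_inj.
by rewrite perm1 /= block_permE block_pos1.
Qed.

Section OperadDef.
Variable K : fieldType.

Record operad_data := OperadData {
  operad_sort :> nat -> vectType K;
  operad_act : forall n, operad_sort n -> 'S_n -> operad_sort n;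
  operad_one : operad_sort 1;
  operad_comp : forall n (m : 'I_n -> nat), operad_sort n ->
    (forall i, operad_sort (m i)) -> operad_sort (\sum_i m i)%N
}.

(* Equality of operations whose arities are provably, but not convertibly,
   equal. *)
Definition eq_ar (P : operad_data) n n' (x : P n) (y : P n') : Prop :=
  existT (operad_sort P) n x = existT (operad_sort P) n' y.

Local Notation "x =ar y" := (eq_ar x y) (at level 70).

Arguments operad_act {_ n}.
Arguments operad_one {_}.
Arguments operad_comp {_ n m}.

Record is_operad (P : operad_data) : Prop := IsOperad {
  operad_act_linear : forall n (s : 'S_n),
    linear (fun x : P n => operad_act x s);
  operad_act1 : forall n (x : P n), operad_act x 1%g = x;
  operad_actM : forall n (x : P n) (s t : 'S_n),
    operad_act (operad_act x s) t = operad_act x (t * s)%g;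
  operad_comp_linearl : forall n (m : 'I_n -> nat) (ys : forall i, P (m i)),
    linear (fun x : P n => operad_comp x ys);
  operad_comp_linearr : forall n (m : 'I_n -> nat) (x : P n)
      (ys : forall i, P (m i)) (i : 'I_n),
    linear (fun y : P (m i) => operad_comp x (dfwith ys y));
  operad_comp1l : forall n (x : P n),
    operad_comp (m := fun=> n) operad_one (fun=> x) =ar x;
  operad_comp1r : forall n (x : P n),
    operad_comp x (fun=> operad_one) =ar x;
  operad_compA : forall n (m : 'I_n -> nat) (l : 'I_(\sum_i m i) -> nat)
      (x : P n) (ys : forall i, P (m i)) (zs : forall k, P (l k)),
    operad_comp (operad_comp x ys) zs =ar
    operad_comp x (fun i => operad_comp (ys i) (fun j => zs (tagnat.Rank i j)));
  operad_comp_actr : forall n (m : 'I_n -> nat) (x : P n)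
      (ys : forall i, P (m i)) (p : forall i, 'S_(m i)),
    operad_comp x (fun i => operad_act (ys i) (p i)) =
    operad_act (operad_comp x ys) (block_perm 1 p);
  operad_comp_actl : forall n (m : 'I_n -> nat) (x : P n)
      (ys : forall i, P (m i)) (s : 'S_n),
    operad_comp (operad_act x s) (fun i => ys (s i)) =ar
    operad_act (operad_comp x ys)
      (cast_perm (sum_perm s m) (block_perm s (fun i => 1%g : 'S_(m (s i)))))
}.

Record operad := Operad {
  operad_base :> operad_data;
  operadP : is_operad operad_base
}.

Record operad_ideal (P : operad) := OperadIdeal {
  ideal_sub :> forall n, {vspace P n};
  ideal_act : forall n (x : P n) (s : 'S_n),
    x \in ideal_sub n -> operad_act x s \in ideal_sub n;
  ideal_comp : forall n (m : 'I_n -> nat) (x : P n) (ys : forall i, P (m i)),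
    x \in ideal_sub n \/ (exists i, ys i \in ideal_sub (m i)) ->
    operad_comp x ys \in ideal_sub (\sum_i m i)%N
}.

Record is_operad_morphism (P Q : operad)
    (f : forall n, P n -> Q n) : Prop := IsOperadMorphism {
  morphism_linear : forall n, linear (f n);
  morphism_act : forall n (x : P n) (s : 'S_n),
    f n (operad_act x s) = operad_act (f n x) s;
  morphism_one : f 1%N operad_one = operad_one;
  morphism_comp : forall n (m : 'I_n -> nat) (x : P n) (ys : forall i, P (m i)),
    f _ (operad_comp x ys) = operad_comp (f n x) (fun i => f _ (ys i))
}.

Definition operad_isomorphic (P Q : operad) : Prop :=
  exists f : forall n, P n -> Q n,
    is_operad_morphism f /\ (forall n, bijective (f n)).

Section Image.
Variables (P : operad) (Q : operad_data) (f : forall n, P n -> Q n).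
Arguments f {n}.
Hypothesis f_lin : forall n, linear (@f n).
Hypothesis f_act : forall n (x : P n) (s : 'S_n),
    f (operad_act x s) = operad_act (f x) s.
Hypothesis f_one : f operad_one = operad_one.
Hypothesis f_comp : forall n (m : 'I_n -> nat) (x : P n) (ys : forall i, P (m i)),
    f (operad_comp x ys) = operad_comp (f x) (fun i => f (ys i)).
Variable g : forall n, Q n -> P n.
Arguments g {n}.
Hypothesis gK : forall n, cancel (@g n) (@f n).

Let gKfun n (m : 'I_n -> nat) (ys : forall i, Q (m i)) : 
  (fun i => f (g (ys i))) = ys.
Proof. by apply: functional_extensionality_dep => i; rewrite gK. Qed.

Let f_Tagged n n' (x : P n) (x' : P n') :
  x =ar x' -> f x =ar f x'.
Proof. exact: (congr1 (fun u : {n & P n} => existT (operad_sort Q) (projT1 u) (f (projT2 u)))). Qed.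

Let f_dfwith n (m : 'I_n -> nat) (ys : forall i, P (m i)) i (y : P (m i)) :
  (fun j => f (dfwith ys y j)) = dfwith (fun j => f (ys j)) (f y).
Proof.
apply: functional_extensionality_dep => j.
have [e|ne] := eqVneq i j; first by subst j; rewrite !dfwith_in.
by rewrite !dfwith_out.
Qed.

Lemma image_is_operad : is_operad Q.
Proof.
have PP := operadP P; split.
- move=> n s a x y; rewrite -[x]gK -[y]gK -f_lin -!f_act -f_lin.
  by rewrite (operad_act_linear PP).
- by move=> n x; rewrite -[x]gK -f_act (operad_act1 PP).
- by move=> n x s t; rewrite -[x]gK -!f_act (operad_actM PP).
- move=> n m ys a x y; rewrite -[x]gK -[y]gK -(gKfun ys) -f_lin -!f_comp -f_lin.
  by rewrite (operad_comp_linearl PP).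
- move=> n m x ys i a y z; rewrite -[x]gK -[y]gK -[z]gK -(gKfun ys) -f_lin.
  by rewrite -!f_dfwith -!f_comp (operad_comp_linearr PP) f_lin.
- move=> n x; rewrite -[x]gK -f_one -f_comp; exact/f_Tagged/operad_comp1l.
- move=> n x; rewrite -[x]gK -f_one -f_comp; exact/f_Tagged/operad_comp1r.
- move=> n m l x ys zs; rewrite -[x]gK -(gKfun ys) -(gKfun zs) -!f_comp.
  set us := fun i => g (ys i); set vs := fun k => g (zs k).
  have -> : (fun i => operad_comp (f (us i)) (fun j => f (vs (tagnat.Rank i j)))) =
            (fun i => f (operad_comp (us i) (fun j => vs (tagnat.Rank i j)))).
    by apply: functional_extensionality_dep => i; rewrite f_comp.
  by rewrite -f_comp; apply/f_Tagged/operad_compA.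
- move=> n m x ys p; rewrite -[x]gK -(gKfun ys) -!f_comp -f_act.
  rewrite -(operad_comp_actr PP) f_comp; congr (operad_comp _ _).
  by apply: functional_extensionality_dep => i; rewrite f_act.
- move=> n m x ys s; rewrite -[x]gK -(gKfun ys) -f_act -!f_comp -f_act.
  by apply/f_Tagged/operad_comp_actl.
Qed.
End Image.

Section Quotient.
Variables (P : operad) (I : operad_ideal P).

Definition quotient_data : operad_data := {|
  operad_sort n := vquot (I n) : vectType K;
  operad_act n q s := vquot_pi (I n) (operad_act (repr q) s);
  operad_one := vquot_pi (I 1%N) operad_one;
  operad_comp n m q rs :=
    vquot_pi (I (\sum_i m i)%N) (operad_comp (repr q) (fun i => repr (rs i)))
|}.

Let f n : P n -> quotient_data n := vquot_pi (I n).

Lemma quotient_piE n (x : P n) (y : P n) : (f x == f y) = (x - y \in I n).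
Proof. exact: eq_vquot_pi. Qed.

Let quotient_reprP n (x : P n) : repr (f x) - x \in I n.
Proof. exact: vquot_repr_pi. Qed.

Lemma quotient_pi_act n (x : P n) (s : 'S_n) :
  f (operad_act x s) = operad_act (f x) s.
Proof.
apply/eqP; rewrite eq_sym quotient_piE.
have lin := operad_act_linear (operadP P) s.
have -> : operad_act (repr (f x)) s - operad_act x s = operad_act (repr (f x) - x) s.
  have /= := lin (-1) x (repr (f x)); rewrite !scaleN1r addrC => <-.
  by congr (operad_act _ _); rewrite addrC.
exact/ideal_act/quotient_reprP.
Qed.

Lemma ideal_comp_congr n (m : 'I_n -> nat) (x x' : P n) (ys ys' : forall i, P (m i)) :
  x - x' \in I n -> (forall i, ys i - ys' i \in I (m i)) ->
  operad_comp x ys - operad_comp x' ys' \in I (\sum_i m i)%N.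
Proof.
move=> Ix Iys.
pose mix (k : nat) (i : 'I_n) := if (i < k)%N then ys' i else ys i.
have subl y y' (zs : forall i, P (m i)) :
    operad_comp y zs - operad_comp y' zs = operad_comp (y - y') zs.
  have /= := operad_comp_linearl (operadP P) zs (-1) y' y.
  by rewrite !scaleN1r addrC => <-; congr (operad_comp _ _); rewrite addrC.
have step k : (k <= n)%N -> operad_comp x ys - operad_comp x (mix k) \in I _.
  elim: k => [_|k IHk lt_kn].
    have -> : mix 0%N = ys by apply: functional_extensionality_dep => i.
    by rewrite subrr mem0v.
  pose i0 := Ordinal lt_kn.
  have mixS : mix k.+1 = dfwith (mix k) (ys' i0).
    apply: functional_extensionality_dep => j.
    have [e|ne] := eqVneq i0 j; first by subst j; rewrite dfwith_in /mix /= ltnSn.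
    rewrite dfwith_out // /mix ltnS leq_eqVlt.
    by have -> : (j == k :> nat) = false by rewrite eq_sym; apply/negbTE.
  have mixk : mix k = dfwith (mix k) (ys i0).
    apply: functional_extensionality_dep => j.
    have [e|ne] := eqVneq i0 j; first by subst j; rewrite dfwith_in /mix /= ltnn.
    by rewrite dfwith_out.
  rewrite -[X in X - _](subrK (operad_comp x (mix k))) -addrA memvD ?IHk ?(ltnW lt_kn) //.
  have /= := operad_comp_linearr (operadP P) x (mix k) (-1) (ys' i0) (ys i0).
  rewrite !scaleN1r -mixS -mixk addrC => <-; apply: ideal_comp; right; exists i0.
  by rewrite dfwith_in addrC Iys.
rewrite -[X in X - _](subrK (operad_comp x ys')) -addrA memvD //; last first.
  by rewrite subl; apply: ideal_comp; left.
have <- : mix n = ys' by apply: functional_extensionality_dep => i; rewrite /mix ltn_ord.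
exact: step.
Qed.

Lemma quotient_pi_comp n (m : 'I_n -> nat) (x : P n) (ys : forall i, P (m i)) :
  f (operad_comp x ys) = operad_comp (f x) (fun i => f (ys i)).
Proof.
apply/eqP; rewrite eq_sym quotient_piE.
by apply: ideal_comp_congr => [|i]; apply: quotient_reprP.
Qed.

Lemma quotient_is_operad : is_operad quotient_data.
Proof.
apply: (@image_is_operad P quotient_data f _ quotient_pi_act _ quotient_pi_comp
   (fun n => @repr _ (vquot (I n)))) => // n.
- exact: linearP.
- exact: vquot_reprK.
Qed.

Definition quotient_operad : operad := Operad quotient_is_operad.

End Quotient.
End OperadDef.

Local Notation "x =ar y" := (eq_ar x y) (at level 70).

Section Com.
Variable K : fieldType.
Definition Com_data : operad_data K := {|
  operad_sort n := K^o : vectType K;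
  operad_act n x s := x;
  operad_one := 1;
  operad_comp n m x ys := x * \prod_i ys i
|}.

Lemma Com_is_operad : is_operad Com_data.
Proof.
have eqar n n' (x y : Com_data n) : n' = n -> x = y ->
    @eq_ar K Com_data n n' x y.
  by move=> e; case: n / e x y => x y ->.
split=> /=.
- by [].
- by [].
- by [].
- by move=> n m ys a x y; rewrite mulrDl scalerAl.
- move=> n m x ys i a y z.
  have E (u : Com_data (m i)) : \prod_j (dfwith (i := i) ys u j : K) =
      (u : K) * \prod_(j | j != i) (ys j : K).
    rewrite (bigD1 i) //; congr (_ * _); first exact: dfwith_in.
    by apply: eq_bigr => j ne; apply: dfwith_out; rewrite eq_sym.
  have H (b c e f : K) : c * (b * e * f) = b * (c * (e * f)).
    by rewrite -!mulrA mulrCA.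
  by rewrite !E mulrDl mulrDr; congr (_ + _); apply: H.
- by move=> n x; apply: eqar; rewrite ?big_ord1 ?mul1r.
- move=> n x; apply: eqar; first by rewrite sum1_card card_ord.
  by rewrite /= big1_eq mulr1.
- move=> n m l x ys zs; apply: eqar; first by rewrite [RHS]big_Rank.
  rewrite -mulrA; congr (_ * _); rewrite big_split /=; congr (_ * _).
  by rewrite [LHS]big_Rank.
- by [].
- move=> n m x ys s; apply: eqar; first by rewrite sum_perm.
  by congr (_ * _); rewrite [RHS](reindex_inj (@perm_inj _ s)).
Qed.
Definition Com : operad K := Operad Com_is_operad.
End Com.

Section Ass.
Variable K : fieldType.

Definition ass_basis n (s : 'S_n) : {ffun 'S_n -> K^o} :=
  [ffun r => (r == s)%:R].

(* The basis element s stands for the monomial in which the variable x_i is in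
   position s i, that is 1_n acted on by s. *)
Definition Ass_data : operad_data K := {|
  operad_sort n := {ffun 'S_n -> K^o} : vectType K;
  operad_act n x t := \sum_s x s *: ass_basis (t * s)%g;
  operad_one := ass_basis 1%g;
  operad_comp n m x ys :=
    \sum_s \sum_(p : {dffun forall i, 'S_(m i)})
      (x s * \prod_i ys i (p i)) *: ass_basis (block_perm s p)
|}.

Local Notation A n := (operad_sort Ass_data n).
Local Notation d := ass_basis.

Lemma ass_basis_sum n (x : A n) : x = \sum_s x s *: d s.
Proof.
apply/ffunP => r; rewrite sum_ffunE (bigD1 r) //= big1 => [|s ne].
  by rewrite !ffunE eqxx addr0 [RHS]mulr1.
by rewrite !ffunE eq_sym (negbTE ne) [LHS]mulr0.
Qed.

Lemma eq_block_perm n (m : 'I_n -> nat) s (p q : forall i, 'S_(m i)) :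
  (forall i, p i = q i) -> block_perm s p = block_perm s q.
Proof. by move=> e; congr block_perm; apply: functional_extensionality_dep. Qed.

Lemma ass_act_basis n (s t : 'S_n) : operad_act (d s : A n) t = d (t * s)%g.
Proof.
rewrite /= (bigD1 s) //= big1 => [|r ne]; rewrite ffunE ?eqxx ?scale1r ?addr0 //.
by rewrite (negbTE ne) scale0r.
Qed.

Lemma ass_comp_basis n (m : 'I_n -> nat) (s : 'S_n) (p : forall i, 'S_(m i)) :
  operad_comp (d s : A n) (fun i => d (p i) : A (m i)) = d (block_perm s p).
Proof.
pose q : {dffun forall i, 'S_(m i)} := [ffun i => p i].
rewrite /= (bigD1 s) //= [X in _ + X]big1 => [|r ne]; last first.
  by rewrite [LHS]big1 // => r' _; rewrite ffunE (negbTE ne) mul0r scale0r.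
rewrite addr0 (bigD1 q) //= [X in _ + X]big1 => [|q' ne]; last first.
  have [i ne_i] : exists i, q' i != p i.
    have [/existsP //|] := boolP [exists i, q' i != p i].
    rewrite negb_exists => /forallP e; case/eqP: ne; apply/ffunP => i.
    by rewrite [q i]ffunE; apply/eqP; rewrite -[_ == _]negbK e.
  rewrite [\prod_(i < n) _](bigD1 i) //= [d (p i) _]ffunE (negbTE ne_i) mul0r mulr0.
  by rewrite scale0r.
rewrite addr0 ffunE eqxx mul1r [\prod_(i < n) _]big1 ?scale1r => [|i _]; last first.
  by rewrite /q !ffunE eqxx.
by congr d; apply: eq_block_perm => i; rewrite ffunE.
Qed.

Lemma ass_act_linear n (t : 'S_n) : linear (fun x : A n => operad_act x t).
Proof.
move=> a x y /=; rewrite scaler_sumr -big_split /=; apply: eq_bigr => s _.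
by rewrite !ffunE scalerDl scalerA.
Qed.

Lemma ass_comp_linearl n (m : 'I_n -> nat) (ys : forall i, A (m i)) :
  linear (fun x : A n => operad_comp x ys).
Proof.
move=> a x y /=; rewrite scaler_sumr -big_split /=; apply: eq_bigr => s _.
rewrite scaler_sumr -big_split /=; apply: eq_bigr => p _.
by rewrite scalerA -scalerDl !ffunE mulrDl mulrA.
Qed.

Lemma ass_comp_linearr n (m : 'I_n -> nat) (x : A n)
    (ys : forall i, A (m i)) (i : 'I_n) :
  linear (fun y : A (m i) => operad_comp x (dfwith ys y)).
Proof.
move=> a y z /=; rewrite scaler_sumr -big_split /=; apply: eq_bigr => s _.
rewrite scaler_sumr -big_split /=; apply: eq_bigr => p _.
rewrite scalerA -scalerDl; congr (_ *: _).
have E (u : A (m i)) : \prod_j dfwith ys u j (p j) =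
    u (p i) * \prod_(j | j != i) ys j (p j).
  rewrite (bigD1 i) //= dfwith_in; congr (_ * _); apply: eq_bigr => j ne.
  by rewrite dfwith_out // eq_sym.
by rewrite !E !ffunE mulrDl mulrDr !mulrA [a * x s]mulrC.
Qed.

Lemma ass_ext n (W : lmodType K) (F G : A n -> W) :
  linear F -> linear G -> (forall s, F (d s) = G (d s)) -> forall x, F x = G x.
Proof.
move=> Fl Gl FG x.
pose F' : {linear A n -> W} := HB.pack F (GRing.isLinear.Build K _ _ _ F Fl).
pose G' : {linear A n -> W} := HB.pack G (GRing.isLinear.Build K _ _ _ G Gl).
rewrite (ass_basis_sum x) -[F]/(F' : _ -> _) -[G]/(G' : _ -> _) !linear_sum.
by apply: eq_bigr => s _; rewrite !linearZ /= FG.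
Qed.

Lemma ass_multi_ext n (m : 'I_n -> nat) (W : lmodType K)
    (F G : (forall i, A (m i)) -> W) :
  (forall ys i, linear (fun y : A (m i) => F (dfwith ys y))) ->
  (forall ys i, linear (fun y : A (m i) => G (dfwith ys y))) ->
  (forall p : forall i, 'S_(m i), F (fun i => d (p i)) = G (fun i => d (p i))) ->
  forall ys, F ys = G ys.
Proof.
move=> Fl Gl FG ys.
have main k : (k <= n)%N -> forall ys : forall i, A (m i),
  (forall i : 'I_n, (k <= i)%N -> exists s, ys i = d s) -> F ys = G ys.
  elim: k => [_ zs H|k IHk lt_kn zs H].
    have bas i : {s | zs i == d s} by apply: sigW; have [s ->] := H i isT; exists s.
    have -> : zs = fun i => d (sval (bas i)).
      by apply: functional_extensionality_dep => i; apply/eqP/(svalP (bas i)).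
    exact: FG.
  pose i0 := Ordinal lt_kn.
  have -> : zs = dfwith zs (zs i0).
    apply: functional_extensionality_dep => j.
    have [e|ne] := eqVneq i0 j; first by subst j; rewrite dfwith_in.
    by rewrite dfwith_out.
  apply: (ass_ext (Fl zs i0) (Gl zs i0)) => s; apply: IHk; first exact: ltnW.
  move=> j le_kj; have [e|ne] := eqVneq i0 j.
    by subst j; exists s; rewrite dfwith_in.
  rewrite dfwith_out //; apply: H; rewrite ltn_neqAle le_kj andbT.
  exact: ne.
by apply: (main n) => // i; rewrite leqNgt ltn_ord.
Qed.

Lemma eq_arP (P : operad_data K) n n' (x : P n) (y : P n') (e : n' = n) :
  x = ecast k (P k) e y -> x =ar y.
Proof. by case: n / e x => x ->. Qed.

Lemma ecast_linear (P : operad_data K) n n' (e : n' = n) :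
  linear (fun y : P n' => ecast k (P k) e y).
Proof. by case: n / e. Qed.

Lemma ecast_basis n n' (e : n' = n) (s : 'S_n) (t : 'S_n') :
  (forall k : 'I_n', s (cast_ord e k) = t k :> nat) ->
  d s = ecast k (A k) e (d t).
Proof.
case: n / e s => s /= E; congr d; apply/permP => k; apply: val_inj.
by have := E k; rewrite cast_ord_id.
Qed.

Lemma ass_compA_basis n (m : 'I_n -> nat) (l : 'I_(\sum_i m i) -> nat)
    (s : 'S_n) (p : forall i, 'S_(m i)) (q : forall k, 'S_(l k))
    (e : (\sum_i \sum_j l (tagnat.Rank i j) = \sum_k l k)%N) k :
  block_perm (block_perm s p) q (cast_ord e k) =
  block_perm s (fun i => block_perm (p i) (fun j => q (tagnat.Rank i j))) k :> nat.
Proof.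
case: (Rank_sig k) => i [j ->]; case: (Rank_sig j) => j0 [r ->].
have -> : cast_ord e (tagnat.Rank i (tagnat.Rank j0 r)) =
          tagnat.Rank (tagnat.Rank i j0) r.
  apply: ord_inj; rewrite -[LHS]/(nat_of_ord (tagnat.Rank i (tagnat.Rank j0 r))).
  rewrite !tagnat.RankEsum.
  have := sum_block_pos 1 (fun=> 1%g) l j0; rewrite block_pos1 block_perm1.
  under eq_bigl do rewrite perm1 tagnat.RankEsum.
  under [in RHS]eq_bigl do rewrite !perm1.
  under [X in _ = (_ + X)%N]eq_bigl do rewrite !perm1.
  by move=> ->; rewrite addnA.
rewrite [LHS]block_permE [RHS]block_permE /block_pos.
rewrite (eq_bigl (fun k0 => (block_perm s p k0 < block_pos s p j0)%N)).
  by rewrite sum_block_pos block_permE /block_pos -addnA.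
by move=> k0; rewrite block_permE.
Qed.

Lemma Ass_is_operad : is_operad Ass_data.
Proof.
split.
- exact: ass_act_linear.
- move=> n; apply: ass_ext => [|//|s]; first exact: ass_act_linear.
  by rewrite ass_act_basis mul1g.
- move=> n x s t; move: x; apply: ass_ext; last first.
  + by move=> r; rewrite !ass_act_basis mulgA.
  + exact: ass_act_linear.
  by move=> a x y; rewrite !(ass_act_linear _ _ _ _).
- exact: ass_comp_linearl.
- exact: ass_comp_linearr.
- move=> n x.
  have e : n = (\sum_(i < 1) n)%N by rewrite big_ord1.
  apply: (eq_arP (e := e)); move: x; apply: ass_ext.
  + move=> a x y.
    have := @ass_comp_linearr 1 (fun=> n) (d 1%g) (fun=> x) ord0 a x y.
    have E (u : A n) : dfwith (fun _ : 'I_1 => x) (i := ord0) u = fun=> u.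
      apply: functional_extensionality_dep => j.
      by rewrite (ord1 j) dfwith_in.
    by rewrite !E.
  + exact: ecast_linear.
  move=> s; rewrite /= [LHS](ass_comp_basis (m := fun _ : 'I_1 => n)).
  apply: ecast_basis => k.
  have -> : cast_ord e k = tagnat.Rank (p_ := fun _ : 'I_1 => n) ord0 k.
    by apply: ord_inj; rewrite [RHS]tagnat.RankEsum [X in (X + _)%N]big_pred0.
  by rewrite block_permE /block_pos big_pred0 // => i; rewrite !perm1.
- move=> n x.
  have e : n = (\sum_(i < n) 1)%N by rewrite sum1_card card_ord.
  apply: (eq_arP (e := e)); move: x; apply: ass_ext.
  + exact: ass_comp_linearl.
  + exact: ecast_linear.
  move=> s; rewrite /= [LHS](ass_comp_basis (m := fun=> 1%N)).
  apply: ecast_basis => k.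
  have cardlt (u : 'I_n) (t : 'S_n) : (\sum_(i | (t i < t u)%N) 1 = t u)%N.
    have lt := ltnW (ltn_ord (t u)).
    transitivity (\sum_(i < n | (i < t u)%N) 1)%N.
      by rewrite [RHS](reindex_inj (@perm_inj _ t)).
    by rewrite (big_ord_narrow lt) sum1_card card_ord.
  have -> : cast_ord e k = tagnat.Rank (p_ := fun _ : 'I_n => 1%N) k ord0.
    apply: ord_inj; rewrite [RHS]tagnat.RankEsum addn0.
    have := cardlt k 1%g; rewrite perm1.
    by under eq_bigl do rewrite perm1.
  rewrite block_permE /block_pos cardlt.
  by rewrite perm1 addn0.
- move=> n m l x ys zs.
  have e : (\sum_i \sum_j l (tagnat.Rank i j) = \sum_k l k)%N.
    by rewrite [RHS]big_Rank.
  pose rhs (x : A n) (ys : forall i, A (m i)) (zs : forall k, A (l k)) :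
      A (\sum_i \sum_j l (tagnat.Rank i j))%N :=
    operad_comp x (fun i =>
      operad_comp (ys i) (fun j => zs (tagnat.Rank i j))).
  apply: (eq_arP (e := e)); rewrite -/(rhs x ys zs).
  move: x; apply: ass_ext => [a x y|a x y|s].
  + by rewrite ass_comp_linearl ass_comp_linearl.
  + by rewrite [rhs _ _ _]ass_comp_linearl ecast_linear.
  move: ys; apply: ass_multi_ext => [ys i a x y|ys i a x y|p].
  + by rewrite ass_comp_linearr ass_comp_linearl.
  + have E (u : A (m i)) : rhs (d s) (dfwith ys u) zs =
        operad_comp (d s : A n) (dfwith (fun i => operad_comp (ys i) (fun j => zs (tagnat.Rank i j)))
          (operad_comp u (fun j => zs (tagnat.Rank i j)))).
      congr operad_comp; apply: functional_extensionality_dep => j.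
      have [e'|ne] := eqVneq i j; first by subst j; rewrite !dfwith_in.
      by rewrite !dfwith_out.
    by rewrite !E ass_comp_linearl ass_comp_linearr ecast_linear.
  move: zs; apply: ass_multi_ext => [zs i a x y|zs k a x y|q].
  + by rewrite ass_comp_linearr.
  + case: (Rank_sig k) x y => i [j ->] x y.
    have E (u : A (l (tagnat.Rank i j))) : rhs (d s) (fun i => d (p i)) (dfwith zs u) =
        operad_comp (d s : A n) (dfwith (fun i => operad_comp (d (p i) : A (m i)) (fun j => zs (tagnat.Rank i j)))
          (operad_comp (d (p i) : A (m i)) (dfwith (fun j => zs (tagnat.Rank i j)) u))).
      congr operad_comp; apply: functional_extensionality_dep => i'.
      have [e'|ne] := eqVneq i i'; last first.
        rewrite dfwith_out //; congr operad_comp.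
        apply: functional_extensionality_dep => j'; rewrite dfwith_out //.
        by rewrite -val_eqE /= tagnat.eq_Rank negb_and ne.
      subst i'; rewrite dfwith_in; congr operad_comp.
      apply: functional_extensionality_dep => j'.
      have [e'|ne] := eqVneq j j'; first by subst j'; rewrite !dfwith_in.
      rewrite !dfwith_out // -val_eqE /= tagnat.eq_Rank negb_and; apply/orP; right.
      exact: ne.
    by rewrite !E ass_comp_linearr ass_comp_linearr ecast_linear.
  rewrite ass_comp_basis [LHS]ass_comp_basis.
  have -> : rhs (d s) (fun i => d (p i)) (fun i => d (q i)) =
      d (block_perm s (fun i => block_perm (p i) (fun j => q (tagnat.Rank i j)))).
    rewrite /rhs -ass_comp_basis; congr operad_comp.
    by apply: functional_extensionality_dep => i; rewrite ass_comp_basis.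
  exact/ecast_basis/ass_compA_basis.
- move=> n m x ys p; move: x; apply: ass_ext => [a x y|a x y|s].
  + by rewrite ass_comp_linearl.
  + by rewrite ass_comp_linearl ass_act_linear.
  move: ys; apply: ass_multi_ext => [ys i a x y|ys i a x y|q].
  + have E (u : A (m i)) :
        (fun j => operad_act (dfwith ys u j) (p j)) =
        dfwith (fun j => operad_act (ys j) (p j)) (operad_act u (p i)).
      apply: functional_extensionality_dep => j.
      have [e|ne] := eqVneq i j; first by subst j; rewrite !dfwith_in.
      by rewrite !dfwith_out.
    by rewrite !E ass_act_linear ass_comp_linearr.
  + by rewrite ass_comp_linearr ass_act_linear.
  have -> : (fun i => operad_act (d (q i) : A (m i)) (p i)) = fun i => d (p i * q i)%g.
    by apply: functional_extensionality_dep => i; rewrite ass_act_basis.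
  rewrite !ass_comp_basis ass_act_basis; congr d; apply/permP => k.
  case: (Rank_sig k) => i [j ->]; apply: ord_inj.
  rewrite permM block_permE.
  have -> : block_perm 1 p (tagnat.Rank i j) = tagnat.Rank i (p i j).
    apply: ord_inj; rewrite block_permE tagnat.RankEsum.
    by congr (_ + _)%N; apply: eq_bigl => i'; rewrite !perm1.
  by rewrite block_permE /block_pos permM.
- move=> n m x ys t.
  apply: (eq_arP (e := esym (sum_perm t m))); move: x; apply: ass_ext => [a x y|a x y|s].
  + by rewrite ass_act_linear ass_comp_linearl.
  + by rewrite ass_comp_linearl ass_act_linear ecast_linear.
  move: ys; apply: ass_multi_ext => [ys i a x y|ys i a x y|q].
  + have [i1 Ei] : {i1 | i = t i1} by exists (t^-1 i)%g; rewrite permKV.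
    subst i; have E (u : A (m (t i1))) :
        (fun j => dfwith ys u (t j)) = dfwith (fun j => ys (t j)) (i := i1) u.
      apply: functional_extensionality_dep => j.
      have [e|ne] := eqVneq i1 j; first by subst j; rewrite !dfwith_in.
      by rewrite !dfwith_out // (inj_eq perm_inj).
    by rewrite !E ass_comp_linearr.
  + by rewrite ass_comp_linearr ass_act_linear ecast_linear.
  rewrite !ass_comp_basis !ass_act_basis [LHS]ass_comp_basis; apply: ecast_basis => k.
  have [k' ->] : {k' | k = cast_ord (sum_perm t m) k'}.
    by exists (cast_ord (esym (sum_perm t m)) k); rewrite cast_ordKV.
  rewrite cast_ordK permM cast_permE cast_ordK.
  case: (Rank_sig k') => i [j ->].
  have -> : cast_ord (sum_perm t m) (block_perm t (fun i => 1%g) (tagnat.Rank i j)) =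
            tagnat.Rank (t i) j.
    apply: ord_inj; rewrite [LHS]block_permE [RHS]tagnat.RankEsum /block_pos perm1.
    congr (_ + _)%N; rewrite [RHS](reindex_inj (@perm_inj _ t)) /=.
    by [].
  rewrite [LHS]block_permE [RHS]block_permE /block_pos permM; congr (_ + _)%N.
  rewrite [RHS](reindex_inj (@perm_inj _ t)) /=.
  by apply: eq_bigl => i'; rewrite permM.
Qed.

Definition Ass : operad K := Operad Ass_is_operad.
End Ass.

Section Truncation.
Variable K : fieldType.

Definition ass_id (n : nat) : Ass K n := ass_basis K 1%g.

(* The arity \sum_i (i \in S) of ass_trunc S x is #|S|. *)
Definition ass_trunc n (S : {set 'I_n}) (x : Ass K n) :
    Ass K (\sum_i (i \in S))%N :=
  operad_comp x (fun i => ass_id (i \in S)).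

Fact ass_trunc_is_linear n (S : {set 'I_n}) : linear (ass_trunc S).
Proof. exact: operad_comp_linearl (operadP (Ass K)) _ _ _. Qed.
HB.instance Definition _ n (S : {set 'I_n}) :=
  GRing.isLinear.Build K (Ass K n) (Ass K (\sum_i (i \in S))%N) _
    (ass_trunc S) (ass_trunc_is_linear S).

(* Only meant for k >= 1.
   In characteristic 3, a - b with a = [[x1,x2],x3], b = [[x2,x3],x1] spans an
   S_3-invariant line M of Upsilon 3 3; the ideal of those x of arity n >= 3
   whose truncations to 2 letters vanish and whose truncations to 3 letters lie
   in M is then strictly between Upsilon 4 and Upsilon 3, and its quotient has
   the same GKdim, 4, as that of Upsilon 4. *)
Definition Upsilon (k n : nat) : {vspace Ass K n} :=
  if (k <= n)%N then
    (\bigcap_(S : {set 'I_n} | #|S| == k.-1) lker (linfun (ass_trunc S)))%VS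
  else 0%VS.

Lemma mem_Upsilon k n (x : Ass K n) : (k <= n)%N ->
  reflect (forall S : {set 'I_n}, #|S| = k.-1 -> ass_trunc S x = 0)
          (x \in Upsilon k n).
Proof.
move=> le_kn; rewrite /Upsilon le_kn; apply: (iffP idP) => [xU S cS | H].
  have /subvP/(_ _ xU) : (\bigcap_(S : {set 'I_n} | #|S| == k.-1)
      lker (linfun (ass_trunc S)) <= lker (linfun (ass_trunc S)))%VS.
    by apply: bigcapv_inf (subvv _); apply/eqP.
  by rewrite memv_ker lfunE => /eqP.
have : (<[x]> <= \bigcap_(S : {set 'I_n} | #|S| == k.-1)
    lker (linfun (ass_trunc S)))%VS; last by [].
apply/subv_bigcapP => S /eqP cS.
by rewrite -memvE memv_ker lfunE /= H.
Qed.

End Truncation.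

(* lne 0 = -oo, so the zero operad has GKdim -oo; the values at n = 0, 1, where
   ln n is 0, do not affect the limsup. *)
Definition GKdim (R : realType) (K : fieldType) (P : operad K) : \bar R :=
  limn_esup (fun n : nat =>
    (lne ((\sum_(i < n.+1) \dim {:P i})%N%:R)%:E * ((ln n%:R)^-1)%:E)%E).

(* Main.v *)
Require Import Defs.
From HB Require Import structures.
From mathcomp Require Import all_classical reals constructive_ereal topology.
From mathcomp Require Import normedtype ereal_normedtype sequences exp ereal.
From mathcomp Require Import all_boot all_order fingroup perm all_algebra zify.

Set Implicit Arguments.
Unset Strict Implicit.
Unset Printing Implicit Defensive.

Import Order.TTheory GRing.Theory Num.Theory numFieldNormedType.Exports.
Local Open Scope ring_scope.

(** An element of Ass(n) is a multilinear noncommutative polynomial in n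
    letters, and an ideal of Ass is a family of such polynomials closed under
    substitution, in particular under setting letters to 1 (composing with the
    operation of arity 0) and under multiplication by new letters.  Everything
    is read off from evaluations [ev] in associative algebras: evaluation turns
    operadic composition into substitution ([ev_comp]), and matrix units detect
    every coefficient ([ev_inj]).

    The basic objects are the proper polynomials, those that vanish as soon as
    one letter is set to 1.  Two facts reduce the theorem to them.
    - If all proper polynomials of arity at least k lie in the ideal J, then J
      contains Upsilon k ([Upsilon_sub]): write x as x_i times x with x_i set
      to 1, plus a remainder that vanishes at x_i = 1, and induct.  As
      Upsilon k is cut out in arity n >= k by C(n, k-1) conditions with values
      in spaces of dimension (k-1)!, the quotient has GKdim at most k.
    - If a proper polynomial g of arity k is not in J, then the C(n, k) copies
      of g on the k-subsets of the letters, each multiplied by the other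
      letters, are linearly independent modulo J ([codim_lower]), so that GKdim
      is at least k+1.

    Hence GKdim < k+1 forces J to contain all proper polynomials of arity at
    least k.  There is no proper polynomial of arity 1; those of arity 2 form a
    line, and those of arity 3 are, as a representation of S_3, the functions
    with sum zero on the three letters (the value being the coefficient of the
    monomials with that letter in the middle), which is irreducible when
    3 is invertible.  So in arities 2 and 3 J contains either all proper
    polynomials or none, and in arity 0 it vanishes, unless it is everything.
    For GKdim 1, 3 and 4 this leaves one possibility; GKdim < 3 forces all
    proper polynomials of arity at least 1 into J, whence GKdim is at most 1.

    For GKdim 5 there are two ideals of identities of algebras of 5 by 5
    matrices: upper triangular matrices with constant diagonal, and a subalgebra
    in which [x1,x2][x3,x4] = 0.  Both contain the proper polynomials of arity
    at least 5, neither contains [[[x1,x2],x3],x4], and they have different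
    dimensions in arity 4. *)

(** * Evaluation of multilinear polynomials *)

Section Evaluation.
Variable K : fieldType.
Implicit Types (A : algType K) (n : nat).

(** The basis element s has the letter i in position s i, so that the letter in
    position k is s^-1 k. *)
Definition ev A n (x : Ass K n) (a : 'I_n -> A) : A :=
  \sum_(s : 'S_n) x s *: \prod_(k < n) a ((s^-1)%g k).

Lemma ev_linear A n (a : 'I_n -> A) : linear (fun x : Ass K n => ev x a).
Proof.
move=> c x y; rewrite /ev scaler_sumr -big_split /=; apply: eq_bigr => s _.
by rewrite !ffunE scalerDl scalerA.
Qed.

Lemma ev0 A n (a : 'I_n -> A) : ev 0 a = 0.
Proof. by rewrite /ev big1 // => s _; rewrite ffunE scale0r. Qed.

Lemma evB A n (x y : Ass K n) (a : 'I_n -> A) : ev (x - y) a = ev x a - ev y a.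
Proof. by rewrite addrC -scaleN1r ev_linear scaleN1r addrC. Qed.

Lemma evZ A n c (x : Ass K n) (a : 'I_n -> A) : ev (c *: x) a = c *: ev x a.
Proof. by have := ev_linear a c x 0; rewrite !addr0 => ->; rewrite ev0 addr0. Qed.

Lemma ev_sum A n (I : finType) (F : I -> Ass K n) (a : 'I_n -> A) :
  ev (\sum_i F i) a = \sum_i ev (F i) a.
Proof.
apply: (big_morph (fun x => ev x a)); last exact: ev0.
by move=> x y; have := ev_linear a 1 x y; rewrite !scale1r.
Qed.

Lemma eq_ev A n (x : Ass K n) (a b : 'I_n -> A) : a =1 b -> ev x a = ev x b.
Proof. by move=> ab; apply: eq_bigr => s _; under eq_bigr do rewrite ab. Qed.

Lemma ev_basis A n (s : 'S_n) (a : 'I_n -> A) :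
  ev (ass_basis K s : Ass K n) a = \prod_(k < n) a ((s^-1)%g k).
Proof.
rewrite /ev (bigD1 s) //= [X in _ + X]big1 ?addr0; first by rewrite ffunE eqxx scale1r.
by move=> r ne; rewrite ffunE (negbTE ne) scale0r.
Qed.

Lemma ev_id A n (a : 'I_n -> A) : ev (ass_id K n) a = \prod_(k < n) a k.
Proof. by rewrite ev_basis invg1; apply: eq_bigr => k _; rewrite perm1. Qed.

Lemma ev_act A n (x : Ass K n) (t : 'S_n) (a : 'I_n -> A) :
  ev (operad_act x t) a = ev x (fun i => a (t^-1 i)%g).
Proof.
move: x; apply: ass_ext => [c x y|c x y|s].
- by rewrite (operad_act_linear (operadP (Ass K))) ev_linear.
- by rewrite ev_linear.
rewrite ass_act_basis !ev_basis; apply: eq_bigr => k _.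
by rewrite invMg permM.
Qed.
End Evaluation.

Section Composition.
Variable K : fieldType.
Implicit Types (A : algType K) (n : nat).

(** Multilinearity of monomials: the letter i occurs once in r, so exactly one
    factor changes. *)
Lemma prod_seq_linear A (I : eqType) (r : seq I) (i : I) (a u v w : I -> A) c :
    uniq r -> i \in r -> (forall j, j != i -> u j = a j) -> (forall j, j != i -> v j = a j) ->
    (forall j, j != i -> w j = a j) -> w i = c *: u i + v i ->
  \prod_(j <- r) w j = c *: \prod_(j <- r) u j + \prod_(j <- r) v j.
Proof.
move=> + + ua va wa wi; elim: r => //= k r IHr /andP[nk ur].
rewrite inE !big_cons; have [ik _|ne /= ir] := eqVneq i k; last first.
  by rewrite wa ?ua ?va 1?eq_sym // IHr // mulrDr scalerAr.
rewrite -{}ik in nk *; have tail (z : I -> A) : (forall j, j != i -> z j = a j) ->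
    \prod_(j <- r) z j = \prod_(j <- r) a j.
  move=> za; apply: eq_big_seq => j jr; apply: za.
  by apply: contraNneq nk => <-.
by rewrite !tail // wi mulrDl scalerAl.
Qed.

Lemma ev_multilinear A n (x : Ass K n) (i : 'I_n) (a u v w : 'I_n -> A) c :
    (forall j, j != i -> u j = a j) -> (forall j, j != i -> v j = a j) ->
    (forall j, j != i -> w j = a j) -> w i = c *: u i + v i ->
  ev x w = c *: ev x u + ev x v.
Proof.
move=> ua va wa wi; rewrite /ev scaler_sumr -big_split /=; apply: eq_bigr => s _.
rewrite scalerA mulrC -scalerA -scalerDr; congr (_ *: _).
have E (z : 'I_n -> A) : \prod_(k < n) z ((s^-1)%g k) =
    \prod_(j <- [seq (s^-1)%g k | k <- index_enum 'I_n]) z j by rewrite big_map.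
rewrite !E; apply: prod_seq_linear ua va wa wi.
  by rewrite map_inj_uniq ?index_enum_uniq //; exact: perm_inj.
by apply/mapP; exists (s i); rewrite ?mem_index_enum // permK.
Qed.

Lemma ev_eq0 A n (x : Ass K n) (i : 'I_n) (a : 'I_n -> A) : a i = 0 -> ev x a = 0.
Proof.
move=> ai; have := @ev_multilinear A n x i a a a a (-1).
by rewrite ai scaler0 addr0 scaleN1r addNr; apply.
Qed.

Lemma prod_nat_blocks A n (f : nat -> nat) (F : nat -> A) :
  \prod_(0 <= k < \sum_(i < n) f i) F k =
  \prod_(i < n) \prod_(j < f i) F (\sum_(i' < i) f i' + j)%N.
Proof.
elim: n => [|n IHn]; first by rewrite !big_ord0 big_geq.
rewrite [RHS]big_ord_recr /= -IHn (big_ord_recr n) /=.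
rewrite (@big_cat_nat _ _ _ (\sum_(i < n) f i)) ?leq_addr //=; congr (_ * _).
rewrite -[X in \prod_(X <= _ < _) _]add0n big_addn addKn big_mkord.
by apply: eq_bigr => j _; rewrite addnC.
Qed.

(** The monomial of a block permutation is the outer monomial with an inner
    monomial substituted for each letter: the positions of the i-th block start
    at the total length of the blocks placed before it. *)
Lemma prod_block_perm A n (m : 'I_n -> nat) (s : 'S_n) (p : forall i, 'S_(m i))
    (b : 'I_(\sum_i m i) -> A) :
  \prod_(k < \sum_i m i) b ((block_perm s p)^-1%g k) =
  \prod_(i < n) \prod_(j < m (s^-1%g i))
     b (tagnat.Rank (s^-1%g i) ((p (s^-1%g i))^-1%g j)).
Proof.
(* The factors and the block lengths as functions on all of nat, where
   concatenated intervals of indices are easier to handle. *)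
pose F k : A := if insub k is Some k' then b ((block_perm s p)^-1%g k') else 1.
pose f i := if insub i is Some i' then m (s^-1%g i') else 0%N.
have fE (i : 'I_n) : f i = m (s^-1%g i) by rewrite /f valK.
have sumf : (\sum_i m i = \sum_(i < n) f i)%N.
  by rewrite (reindex_inj (@perm_inj _ s^-1%g)); apply: eq_bigr => i _; rewrite fE.
transitivity (\prod_(0 <= k < \sum_(i < n) f i) F k).
  by rewrite -sumf big_mkord; apply: eq_bigr => k _; rewrite /F valK.
rewrite prod_nat_blocks; apply: eq_bigr => i _; rewrite fE.
apply: eq_bigr => j _; set k := tagnat.Rank _ _.
have -> : (\sum_(i' < i) f i' + j)%N = block_perm s p k.
  rewrite block_permE /block_pos permKV; congr (_ + _)%N; last by rewrite permKV.
  rewrite (reindex_inj (@perm_inj _ s^-1%g)) /=.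
  under [RHS]eq_bigl do rewrite !permKV.
  under [RHS]eq_bigr do rewrite -fE.
  by rewrite (big_ord_narrow (ltnW (ltn_ord i))).
by rewrite /F valK permK.
Qed.

(** Composition is substitution.  Both sides are linear in x and multilinear in
    the ys, so basis elements suffice. *)
Lemma ev_comp A n (m : 'I_n -> nat) (x : Ass K n) (ys : forall i, Ass K (m i))
    (b : 'I_(\sum_i m i) -> A) :
  ev (operad_comp x ys) b =
  ev x (fun i => ev (ys i) (fun j => b (tagnat.Rank i j))).
Proof.
move: x; apply: ass_ext => [c x y|c x y|s].
- by rewrite (operad_comp_linearl (operadP (Ass K))) ev_linear.
- by rewrite ev_linear.
move: ys; apply: (@ass_multi_ext K n m A).
- by move=> ys i c u v; rewrite (operad_comp_linearr (operadP (Ass K))) ev_linear.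
- move=> ys i c u v; 
  apply: (@ev_multilinear _ _ _ i (fun j => ev (ys j) (fun l => b (tagnat.Rank j l)))).
  1-3: by move=> j ne; rewrite dfwith_out // eq_sym.
  by rewrite !dfwith_in ev_linear.
move=> p; rewrite ass_comp_basis !ev_basis.
apply: etrans (prod_block_perm _ _ _) _.
by apply: eq_bigr => i _; rewrite ev_basis.
Qed.
End Composition.

(** * Faithfulness and substitutions *)

Section Faithful.
Variable K : fieldType.

(** A row vector e_0 is moved one step to the right by e_(k,k+1) exactly when it
    has arrived at column k, so the product survives only if the units come in
    the order 0, 1, and so on. *)
Lemma row_prod_units n (f : nat -> nat) m : (m <= n)%N -> (forall k, (k < m)%N -> (f k < n)%N) ->
  (delta_mx 0 ord0 : 'rV[K]_n.+1) *m
    \prod_(k < m) (delta_mx (inord (f k)) (inord (f k).+1) : 'M[K]_n.+1) =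
  [forall k : 'I_m, f k == k]%:R *: delta_mx 0 (inord m).
Proof.
elim: m => [_ _|m IHm le_mn fn].
  rewrite big_ord0 mulmx1; have -> : [forall k : 'I_0, f k == k] by apply/forallP => -[].
  by rewrite scale1r; congr delta_mx; apply: val_inj; rewrite /= inordK.
have fnm : (f m < n)%N by apply: fn.
rewrite big_ord_recr /= mulmxA IHm 1?ltnW //; last by move=> k km; apply/fn/ltnW.
rewrite -scalemxAl mul_delta_mx_cond.
have -> : [forall k : 'I_m.+1, f k == k] = [forall k : 'I_m, f k == k] && (f m == m).
  apply/forallP/andP => [H|[/forallP H1 H2] k].
    split; first by apply/forallP => k; exact: (H (widen_ord (leqnSn m) k)).
    exact: (H ord_max).
  have [km|] := ltnP k m; first exact: (H1 (Ordinal km)).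
  rewrite leq_eqVlt ltnNge -ltnS ltn_ord orbF => /eqP <-; exact: H2.
have -> : (inord m == inord (f m) :> 'I_n.+1) = (f m == m).
  by rewrite -val_eqE /= !inordK 1?eq_sym // ltnS ltnW.
case: eqP => [->|_]; first by rewrite andbT mulr1n.
by rewrite andbF mulr0n scaler0 scale0r.
Qed.

(** Reading the coefficient of a monomial off the corner entry: a product of
    the matrix units e_(i,i+1) has a nonzero corner only in the right order. *)
Lemma ev_matrix_units n (x : Ass K n) (t : 'S_n) :
  ev x (fun i => delta_mx (inord (t i)) (inord (t i).+1) : 'M[K]_n.+1)
    ord0 ord_max = x t.
Proof.
rewrite /ev summxE (bigD1 t) //= [X in _ + X]big1 ?addr0 => [|s ne]; rewrite mxE.
  under eq_bigr do rewrite permKV.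
  set M := \prod_(k < n) _.
  have : ((delta_mx 0 ord0 : 'rV[K]_n.+1) *m M) 0 ord_max = 1.
    rewrite (@row_prod_units n id n) //.
    have -> : [forall k : 'I_n, k == k :> nat] by apply/forallP => k.
    rewrite scale1r mxE eqxx /=; suff -> : ord_max == inord n :> 'I_n.+1 by [].
    by rewrite -val_eqE /= inordK.
  by rewrite -rowE mxE => ->; rewrite mulr1.
pose f k := if insub k is Some k' then t (s^-1%g k') : nat else 0%N.
have fE (k : 'I_n) : f k = t (s^-1%g k) by rewrite /f valK.
under eq_bigr do rewrite -fE.
set M := \prod_(k < n) _.
suff : ((delta_mx 0 ord0 : 'rV[K]_n.+1) *m M) 0 ord_max = 0.
  by rewrite -rowE mxE => ->; rewrite mulr0.
rewrite row_prod_units // => [|k kn]; last by rewrite (fE (Ordinal kn)).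
case: forallP => [H|_]; last by rewrite scale0r mxE.
case/eqP: ne; apply/permP => i; apply/val_inj => /=.
by have := H (s i); rewrite fE permK => /eqP.
Qed.

(** Hence identities between polynomials, in which arities need not agree
    definitionally, can be checked on evaluations. *)
Lemma ev_inj n (x y : Ass K n) :
  (forall N (a : 'I_n -> 'M[K]_N.+1), ev x a = ev y a) -> x = y.
Proof. by move=> E; apply/ffunP => t; rewrite -!ev_matrix_units E. Qed.
End Faithful.

Section Letters.
Variable K : fieldType.
Implicit Types (A : algType K).

(** Transports x along a bijection of letters and an equality of arities that
    need not hold definitionally.  The last clause, here and below, is what
    makes such constructions usable for an ideal J that is known only through
    its closure properties. *)
Lemma relabel n n' (x : Ass K n) (f : 'I_n' -> 'I_n) : n' = n -> injective f ->
  exists y : Ass K n',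
    (forall A (b : 'I_n -> A), ev y (b \o f) = ev x b) /\
    (forall J : operad_ideal (Ass K), x \in J n -> y \in J n').
Proof.
move=> e; case: n / e x f => x f fI; exists (operad_act x (perm fI)); split; last first.
  by move=> J xJ; apply: ideal_act.
move=> A b; rewrite ev_act; apply: eq_ev => i /=.
by congr b; rewrite -[RHS](permKV (perm fI)) permE.
Qed.

(** The product of two polynomials in disjoint letters. *)
Lemma juxtapose p q (x : Ass K p) (y : Ass K q) :
  exists z : Ass K (p + q)%N,
    (forall A (b : 'I_(p + q)%N -> A),
       ev z b = ev x (b \o lshift q) * ev y (b \o @rshift p q)) /\
    (forall J : operad_ideal (Ass K), x \in J p \/ y \in J q -> z \in J (p + q)%N).
Proof.
(* The composite of x_1 x_2 with x and y. *)
pose m (i : 'I_2) := if i == ord0 then p else q.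
pose ys (i : 'I_2) : Ass K (m i) :=
  if i == ord0 as c return Ass K (if c then p else q) then x else y.
have e : (p + q = \sum_i m i)%N by rewrite big_ord_recl big_ord1.
have [z [zE zJ]] := relabel (operad_comp (ass_id K 2) ys) e (@cast_ord_inj _ _ e).
exists z; split=> [A b|J xyJ]; last first.
  apply/zJ/ideal_comp; right; case: xyJ => [xJ|yJ]; first by exists ord0.
  by exists ord_max.
have -> : ev z b = ev z ((b \o cast_ord (esym e)) \o cast_ord e).
  by apply: eq_ev => i /=; rewrite cast_ordK.
rewrite zE ev_comp ev_id big_ord_recl big_ord1; congr (_ * _).
  apply: eq_ev => i /=; congr b; apply: val_inj.
  by rewrite [LHS]tagnat.RankEsum big_pred0 // => j; rewrite ltn0.
rewrite (_ : lift ord0 ord0 = ord_max :> 'I_2); last exact: val_inj.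
apply: eq_ev => i /=; congr b; apply: val_inj.
rewrite [LHS]tagnat.RankEsum big_mkcond big_ord_recl big_ord1 /=.
by rewrite addn0.
Qed.

(** A substitution of the letters in the image of f, the other letters being set
    to 1. *)
Definition extend A k n (f : 'I_k -> 'I_n) (b : 'I_k -> A) (i : 'I_n) : A :=
  if [pick j | f j == i] is Some j then b j else 1.

Lemma extend_in A k n (f : 'I_k -> 'I_n) (b : 'I_k -> A) j :
  injective f -> extend f b (f j) = b j.
Proof.
move=> fI; rewrite /extend; case: pickP => [j' /eqP/fI -> //|/(_ j)].
by rewrite eqxx.
Qed.

Lemma extend_out A k n (f : 'I_k -> 'I_n) (b : 'I_k -> A) i :
  i \notin codom f -> extend f b i = 1.
Proof.
move=> ni; rewrite /extend; case: pickP => // j /eqP e.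
by case/negP: ni; rewrite -e codom_f.
Qed.

Lemma extend_lift A n (i : 'I_n.+1) (b : 'I_n -> A) : extend (lift i) b i = 1.
Proof.
by apply: extend_out; apply/negP => /codomP[l e]; have := neq_lift i l; rewrite -e eqxx.
Qed.

Lemma ev_ass_trunc A n (S : {set 'I_n}) (x : Ass K n) (c : 'I_(\sum_i (i \in S)) -> A) :
  ev (ass_trunc S x) c = ev x (fun i => \prod_(j < (i \in S)) c (tagnat.Rank i j)).
Proof. by rewrite ev_comp; apply: eq_ev => i; rewrite ev_id. Qed.

Lemma ev_ass_trunc1 A n (S : {set 'I_n}) (x : Ass K n) (a : 'I_n -> A) :
  (forall i, i \notin S -> a i = 1) ->
  ev (ass_trunc S x) (a \o tagnat.sig1) = ev x a.
Proof.
move=> a1; rewrite ev_ass_trunc; apply: eq_ev => i.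
transitivity (\prod_(j < (i \in S)) a i).
  by apply: eq_bigr => j _; rewrite /= tagnat.Rank1K.
by case: (i \in S) (a1 i) => [_|->]; rewrite ?big_ord1 ?big_ord0.
Qed.

Lemma sum_mem_card n (S : {set 'I_n}) : (\sum_i (i \in S) = #|S|)%N.
Proof. by rewrite -sum1_card [RHS]big_mkcond. Qed.

(** A truncation: the letters outside the image of f are set to 1, and the
    remaining ones are renumbered by f.  Unlike [ass_trunc] it has a
    prescribed arity. *)
Lemma restrict k n (x : Ass K n) (f : 'I_k -> 'I_n) : injective f ->
  exists y : Ass K k,
    (forall A (b : 'I_k -> A), ev y b = ev x (extend f b)) /\
    (forall J : operad_ideal (Ass K), x \in J n -> y \in J k).
Proof.
move=> fI; pose S := [set i in codom f].
have fS j : (0 < (f j \in S))%N by rewrite inE codom_f.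
pose g j : 'I_(\sum_i (i \in S)) := tagnat.Rank (f j) (Ordinal (fS j)).
have gI : injective g.
  by move=> j j' /(congr1 (@tagnat.sig1 _ _)); rewrite !tagnat.Rank1K => /fI.
have e : k = (\sum_i (i \in S))%N.
  by rewrite sum_mem_card cardsE (card_codom fI) card_ord.
have [y [yE yJ]] := relabel (ass_trunc S x) e gI.
exists y; split=> [A b|J xJ]; last by apply/yJ/ideal_comp; left.
rewrite -(@ev_ass_trunc1 A n S); last by move=> i; rewrite inE; apply: extend_out.
rewrite -yE; apply: eq_ev => j /=.
by rewrite tagnat.Rank1K extend_in.
Qed.
End Letters.

(** * Truncations and proper polynomials *)

Section Truncations.
Variable K : fieldType.

Definition vanish_on n (x : Ass K n) (S : {set 'I_n}) : Prop :=
  forall N (a : 'I_n -> 'M[K]_N.+1), (forall i, i \notin S -> a i = 1) -> ev x a = 0.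

(** Classically, these are the multilinear combinations of products of
    commutators. *)
Definition is_proper n (x : Ass K n) : Prop :=
  forall N (a : 'I_n -> 'M[K]_N.+1) i, a i = 1 -> ev x a = 0.

Lemma mem_Upsilon_vanish k n (x : Ass K n) : (k <= n)%N ->
  (x \in Upsilon K k n) <-> forall S : {set 'I_n}, #|S| = k.-1 -> vanish_on x S.
Proof.
move=> le_kn; split=> [/(mem_Upsilon _ le_kn) H S cS N a a1|H].
  by rewrite -(ev_ass_trunc1 _ a1) H // ev0.
apply/(mem_Upsilon _ le_kn) => S cS; apply: ev_inj => N c.
rewrite ev0 ev_ass_trunc; apply: (H S cS) => i ni.
by rewrite big1 // => j _; case: j => j lt_j; exfalso; move: (lt_j); rewrite (negbTE ni).
Qed.

(** The polynomial z is x_i times x with x_i set to 1; it coincides with x at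
    x_i = 1. *)
Lemma split_letter n (x : Ass K n.+1) (i : 'I_n.+1) :
  exists (y : Ass K n) (z : Ass K n.+1),
  [/\ forall N (b : 'I_n -> 'M[K]_N.+1), ev y b = ev x (extend (lift i) b),
      forall N (a : 'I_n.+1 -> 'M[K]_N.+1),
        ev z a = a i * ev x (fun j => if j == i then 1 else a j)
    & forall J : operad_ideal (Ass K), y \in J n -> z \in J n.+1].
Proof.
have [y [yE _]] := restrict x (@lift_inj _ i).
have [z [zE zJ]] := juxtapose (ass_id K 1) y.
exists y, (operad_act (z : Ass K n.+1) (lift_perm i ord0 1%g)); split.
- by move=> N b; rewrite yE.
- move=> N a; rewrite ev_act lift_permV invg1 zE ev_id big_ord1 yE; congr (_ * _).
    by rewrite /= (_ : lshift n ord0 = ord0) ?lift_perm_id //; apply: val_inj.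
  apply: eq_ev => j; have [->|] := eqVneq j i.
    by rewrite extend_lift.
  rewrite eq_sym => /unlift_some[k -> _]; rewrite extend_in; last exact: lift_inj.
  rewrite /= (_ : rshift 1 k = lift ord0 k) ?lift_perm_lift ?perm1 //; exact: val_inj.
- by move=> J yJ; apply/ideal_act/zJ; right.
Qed.

(** By induction on the arity n, and for given n on the number of letters at
    which x does not vanish when set to 1 (Q is the set of the other letters).
    With z from [split_letter], z is in J because x with x_i set to 1 has
    smaller arity, and x - z vanishes also at x_i = 1.  When Q contains all
    letters, x is proper. *)
Lemma Upsilon_sub (J : operad_ideal (Ass K)) k : (0 < k)%N ->
    (forall m (x : Ass K m), (k <= m)%N -> is_proper x -> x \in J m) ->
  forall n, (Upsilon K k n <= J n)%VS.
Proof.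
move=> k0 HJ; elim=> [|n IHn].
  by rewrite /Upsilon leqNgt k0 sub0v.
have [lt_nk|le_kn] := ltnP n.+1 k; first by rewrite /Upsilon leqNgt lt_nk sub0v.
suff main d : forall (Q : {set 'I_n.+1}) (x : Ass K n.+1), (#|~: Q| <= d)%N ->
    (forall i, i \in Q -> vanish_on x (~: [set i])) ->
    x \in Upsilon K k n.+1 -> x \in J n.+1.
  apply/subvP => x; apply: (main _ set0 x (leqnn _)) => i; by rewrite inE.
elim: d => [|d IHd] Q x.
  rewrite leqn0 cards_eq0 => /eqP Q0 xQ _; apply: HJ => // N a i ai.
  apply: (xQ i); last by move=> j; rewrite !inE negbK => /eqP ->.
  by move/setP/(_ i): Q0; rewrite !inE => /negbFE.
move=> cQ xQ xU; have [Q0|[i]] := set_0Vmem (~: Q).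
  by apply: (IHd Q) => //; rewrite Q0 cards0.
rewrite inE => iQ; have [y [z [yE zE zJ]]] := split_letter x i.
have xV := (mem_Upsilon_vanish x le_kn).1 xU.
have yJ : y \in J n.
  have [lt_nk|le_kn'] := ltnP n k.
    (* Here k = n.+1, and y is the truncation of x to n = k.-1 letters. *)
    suff -> : y = 0 by rewrite mem0v.
    apply: ev_inj => N b; rewrite yE ev0; apply: (xV (~: [set i])).
      by rewrite cardsC1 card_ord; suff -> : k = n.+1 by []; apply/eqP; rewrite eqn_leq le_kn.
    move=> j; rewrite !inE negbK => /eqP ->; apply: extend_lift.
  apply: (subvP (IHn)); apply/(mem_Upsilon_vanish y le_kn') => S cS N b b1.
  rewrite yE; apply: (xV (lift i @: S)).
    by rewrite card_imset //; apply: lift_inj.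
  move=> j jS; have [/codomP[l e]|nj] := boolP (j \in codom (lift i)); last exact: extend_out.
  rewrite e extend_in; last exact: lift_inj.
  by apply: b1; apply: contra jS => lS; rewrite e imset_f.
have wE N (a : 'I_n.+1 -> 'M[K]_N.+1) (T : {set 'I_n.+1}) :
    (forall j, j \notin T -> a j = 1) -> vanish_on x T -> ev (x - z) a = 0.
  move=> aT xT; rewrite evB zE (xT _ a aT) xT ?mulr0 ?subr0 // => j jT.
  by rewrite aT // if_same.
rewrite -(subrK z x) memvD ?zJ //; apply: (IHd (i |: Q)).
- rewrite -ltnS; apply: leq_trans cQ; rewrite setCU setIC -setDE.
  by rewrite [X in (_ <= X)%N](cardsD1 i) inE iQ.
- move=> j; rewrite in_setU1 => /orP[/eqP -> N a ai|jQ N a aj].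
    rewrite evB zE ai ?mul1r ?inE ?eqxx //; apply/eqP; rewrite subr_eq0; apply/eqP/eq_ev => j'.
    by case: eqP => // ->; apply: ai; rewrite !inE eqxx.
  exact: (wE N a _ aj (xQ j jQ)).
by apply/(mem_Upsilon_vanish _ le_kn) => S cS N a aS; apply: (wE N a S aS (xV S cS)).
Qed.
End Truncations.

(** * Codimensions *)

Section Codimension.
Variable K : fieldType.

Lemma dim_vquot (V : vectType K) (U : {vspace V}) :
  \dim {: vquot U} = (dim V - \dim U)%N.
Proof. by rewrite [LHS]dimvf -[dim V]dimvf -dimv_compl. Qed.

Lemma dim_Ass n : dim (Ass K n) = n`!.
Proof.
by rewrite [LHS](_ : _ = (#|{: 'S_n}| * 1)%N) // muln1 card_Sn.
Qed.

(** Vectors that are linearly independent modulo U span a space of full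
    dimension that meets U trivially. *)
Lemma independent_mod (V : vectType K) (U : {vspace V}) m (e : 'I_m -> V) :
  (forall c : 'I_m -> K, \sum_i c i *: e i \in U -> forall i, c i = 0) ->
  (m <= dim V - \dim U)%N.
Proof.
move=> H; pose X := [tuple e i | i < m].
have XE (c : 'I_m -> K) : \sum_i c i *: X`_i = \sum_i c i *: e i.
  by apply: eq_bigr => i _; rewrite (nth_map i) ?size_enum_ord // nth_ord_enum.
have fX : free X by apply/freeP => c; rewrite XE => E; apply: H; rewrite E mem0v.
have dis : (U :&: <<X>> = 0)%VS.
  apply/eqP; rewrite -subv0; apply/subvP => v; rewrite memv_cap => /andP[vU vX].
  move: vU; rewrite (coord_span vX) XE memv0 => /H c0.
  by rewrite big1 // => i _; rewrite c0 scale0r.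
have := dimvS (subvf (U + <<X>>)%VS); rewrite dimvf dimv_disjoint_sum //.
have /eqP -> : free X := fX.
by rewrite size_tuple => le; rewrite leq_subRL ?(leq_trans (leq_addr _ _) le).
Qed.

Lemma codim_bigcap (V : vectType K) (I : Type) (r : seq I) (P : pred I) (U : I -> {vspace V}) c :
  (forall i, P i -> dim V <= \dim (U i) + c)%N ->
  (dim V <= \dim (\bigcap_(i <- r | P i) U i)%VS + count P r * c)%N.
Proof.
move=> H; elim: r => [|i r IHr]; first by rewrite big_nil dimvf leq_addr.
rewrite big_cons /=; case: ifP => // Pi; rewrite add1n mulSn.
set W := (\bigcap_(i <- r | P i) U i)%VS in IHr *.
have := dimv_sum_cap (U i) W; have := dimvS (subvf (U i + W)%VS); rewrite dimvf.
by move: (H i Pi) IHr; lia.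
Qed.

Lemma codim_lker (V W : vectType K) (f : 'Hom(V, W)) : (dim V <= \dim (lker f) + dim W)%N.
Proof.
have := limg_ker_dim f fullv; rewrite capfv dimvf => <-.
by rewrite leq_add2l -dimvf dimvS // subvf.
Qed.

(** Upsilon k n is an intersection of C(n, k-1) kernels of maps to Ass(k-1). *)
Lemma codim_Upsilon k n : (0 < k <= n)%N ->
  (n`! <= \dim (Upsilon K k n) + 'C(n, k.-1) * (k.-1)`!)%N.
Proof.
move=> /andP[k0 le_kn]; rewrite /Upsilon le_kn.
have cB : count (fun S : {set 'I_n} => #|S| == k.-1) (index_enum {set 'I_n}) = 'C(n, k.-1).
  rewrite -[in RHS](card_ord n) -card_draws cardE -size_filter /enum_mem.
  by congr size; apply: eq_filter => S; rewrite !inE.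
rewrite -cB -dim_Ass; apply: codim_bigcap => S /eqP cS.
by rewrite -cS -sum_mem_card -dim_Ass; apply: codim_lker.
Qed.

(** To be composed with the product of n - k letters by a polynomial g in k
    letters, so that g lands on S. *)
Lemma juxtapose_at k n (S : {set 'I_n}) : #|S| = k ->
  exists h : 'I_(n - k + k) -> 'I_n,
  [/\ injective h, forall i, h (lshift k i) \notin S & forall j, h (rshift (n - k) j) \in S].
Proof.
move=> cS; have cT : #|~: S| = (n - k)%N by rewrite cardsCs setCK card_ord cS.
pose h (l : 'I_(n - k + k)) : 'I_n := match split l with
  | inl i => enum_val (cast_ord (esym cT) i) | inr j => enum_val (cast_ord (esym cS) j) end.
have hl i : h (lshift k i) = enum_val (cast_ord (esym cT) i).
  by rewrite /h (unsplitK (inl i)).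
have hr j : h (rshift (n - k) j) = enum_val (cast_ord (esym cS) j).
  by rewrite /h (unsplitK (inr j)).
have hlS i : h (lshift k i) \notin S by rewrite hl -in_setC enum_valP.
have hrS j : h (rshift (n - k) j) \in S by rewrite hr enum_valP.
exists h; split=> // u v; case: (split_ordP u) => i ->; case: (split_ordP v) => j ->.
- by rewrite !hl => /enum_val_inj/cast_ord_inj ->.
- by move=> e; case/negP: (hlS i); rewrite e.
- by move=> e; case/negP: (hlS j); rewrite -e.
by rewrite !hr => /enum_val_inj/cast_ord_inj ->.
Qed.

(** Truncating a linear combination of the copies of g to the letters of S0 kills
    the copy on any other k-set S, since a letter of S is set to 1 and g is
    proper; it leaves the copy on S0, which is g up to its coefficient. *)
Lemma codim_lower (J : operad_ideal (Ass K)) k n (g : Ass K k) :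
  is_proper g -> g \notin J k -> ('C(n, k) <= dim (Ass K n) - \dim (J n))%N.
Proof.
move=> gP gJ; have [lt_nk|le_kn] := ltnP n k; first by rewrite bin_small.
pose T := {S : {set 'I_n} | #|S| == k}.
have cT : #|{: T}| = 'C(n, k).
  by rewrite card_sig -[in RHS](card_ord n) -card_draws; apply: eq_card => S; rewrite !inE.
have /choice[h hP] (S : T) : exists h : 'I_(n - k + k) -> 'I_n,
  [/\ injective h, forall i, h (lshift k i) \notin val S
    & forall j, h (rshift (n - k) j) \in val S].
  exact/juxtapose_at/eqP/(valP S).
have en : n = (n - k + k)%N by rewrite subnK.
have /choice[e eP] (S : T) : exists e : Ass K n, forall N (b : 'I_n -> 'M[K]_N.+1),
    ev e b = (\prod_i b (h S (lshift k i))) * ev g (fun j => b (h S (rshift (n - k) j))).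
  have [z [zE _]] := juxtapose (ass_id K (n - k)) g.
  have [hI _ _] := hP S.
  have hB : bijective (h S).
    by apply: inj_card_bij; rewrite // !card_ord -en.
  have [h' hK h'K] := hB.
  have [y [yE _]] := relabel z en (can_inj h'K).
  exists y => N b; rewrite (@eq_ev _ _ _ y b ((b \o h S) \o h')); last first.
    by move=> i /=; rewrite h'K.
  by rewrite yE zE ev_id.
rewrite -cT; apply: (@independent_mod _ _ _ (fun i => e (enum_val i))) => c cJ i0.
set S0 := enum_val i0; have [h0I h0l h0r] := hP S0.
(* The truncation to the letters of S0. *)
pose f0 j := h S0 (rshift (n - k) j).
have f0I : injective f0 by move=> j j' /h0I/rshift_inj.
have [y [yE yJ]] := restrict (\sum_i c i *: e (enum_val i)) f0I.
have extS0 (A : algType K) (b : 'I_k -> A) i : i \notin val S0 -> extend f0 b i = 1.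
  by move=> iS; apply: extend_out; apply: contra iS => /codomP[j ->]; exact: h0r.
have yg : y = c i0 *: g.
  apply: ev_inj => N b; rewrite yE ev_sum (bigD1 i0) //= big1 ?addr0.
    rewrite !evZ eP -/S0 big1 ?mul1r => [|i _]; last exact: extS0.
    by congr (_ *: _); apply: eq_ev => j; rewrite extend_in.
  move=> i ne; rewrite evZ eP; set S := enum_val i.
  have [hI hl hr] := hP S.
  have [l lS lS0] : exists2 l, l \in val S & l \notin val S0.
    apply/subsetPn; apply: contra ne => sub; apply/eqP/enum_val_inj/val_inj/eqP.
    by rewrite eqEcard sub (eqP (valP S0)) (eqP (valP S)) leqnn.
  have hB : bijective (h S) by apply: inj_card_bij; rewrite // !card_ord -en.
  have [h' hK h'K] := hB.
  have [j lj] : exists j, l = h S (rshift (n - k) j).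
    case: (split_ordP (h' l)) => j e'; last by exists j; rewrite -e' h'K.
    by case/negP: (hl j); rewrite -e' h'K.
  by rewrite (gP _ _ j) ?mulr0 ?scaler0 // -lj extS0.
apply/eqP; apply: contraNT gJ => ci0; have := yJ J cJ.
by rewrite yg => /(memvZ (c i0)^-1); rewrite scalerA mulVf // scale1r.
Qed.
End Codimension.

(** * Growth *)

Section Growth.
Variable R : realType.
Local Open Scope classical_set_scope.
Local Open Scope ereal_scope.

(** Shrinking the neighbourhoods of infinity does not affect the infimum of the
    suprema. *)
Lemma le_limn_esup_near (u v : (\bar R)^nat) :
  (\forall n \near \oo, u n <= v n) -> limn_esup u <= limn_esup v.
Proof.
move=> [m _ uv]; rewrite /limn_esup !limf_esupE.
apply: le_ereal_inf_tmp => _ [V VF <-].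
have WF : \oo (V `&` [set n | (m <= n)%N]) by apply: filterI => //; exists m.
apply: (@le_trans _ _ (ereal_sup (u @` (V `&` [set n | (m <= n)%N])))).
  by apply: ereal_inf_lbound; exists (V `&` [set n | (m <= n)%N]).
apply: ge_ereal_sup => _ [n [Vn mn] <-].
by apply: le_trans (uv n mn) _; apply: ereal_sup_ubound; exists n.
Qed.

Lemma cvg_inv_ln : ((ln n%:R : R)^-1)%R @[n --> \oo] --> (0 : R)%R.
Proof.
apply/cvgrVy.
  by exists 2%N => // n /= n2; rewrite invr_gt0 ln_gt0 // ltr1n.
apply/cvgryPge => A; near=> n; rewrite /= invrK -[A]expRK ler_ln ?posrE ?expR_gt0 //.
  by near: n; apply: nbhs_infty_ger.
by apply: lt_le_trans (expR_gt0 A) _; near: n; apply: nbhs_infty_ger.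
Unshelve. all: by end_near.
Qed.

Definition log_growth (u : nat -> nat) : \bar R :=
  limn_esup (fun n => lne (u n)%:R%:E * ((ln n%:R)^-1)%:E).

(** ln (c n^d) / ln n = d + ln c / ln n, which tends to d. *)
Lemma log_poly (c : R) (d n : nat) : (0 < c)%R -> (1 < n)%N ->
  lne (c * n%:R ^+ d)%:E * ((ln n%:R)^-1)%:E = (d%:R + ln c * (ln n%:R)^-1)%R%:E :> \bar R.
Proof.
move=> c0 n1; have n0 : (0 < n)%N by apply: ltnW.
rewrite lne_EFin ?mulr_gt0 ?exprn_gt0 ?ltr0n // -EFinM; congr EFin.
rewrite lnM ?posrE ?exprn_gt0 ?ltr0n // lnXn ?ltr0n // mulrDl addrC.
by rewrite -[(ln _ *+ d)%R]mulr_natl mulfK // gt_eqF // ln_gt0 // ltr1n.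
Qed.

Lemma limn_log_poly (c : R) (d : nat) : (0 < c)%R ->
  limn_esup (fun n => lne (c * n%:R ^+ d)%:E * ((ln n%:R)^-1)%:E) = d%:R%:E :> \bar R.
Proof.
move=> c0; apply: (cvg_limn_einf_sup _).2.
have H : (d%:R + ln c * (ln n%:R)^-1)%R%:E @[n --> \oo] --> (d%:R%:E : \bar R).
  apply: cvg_EFin; first by apply: nearW.
  rewrite -[X in _ --> X]addr0 -(mulr0 (ln c)).
  by apply: cvgD; [exact: cvg_cst|apply: cvgMr; exact: cvg_inv_ln].
apply: cvg_trans H; apply: near_eq_cvg.
by exists 2%N => // n /= n1; rewrite log_poly.
Qed.

Lemma le_log_ratio (x y : R) n : (0 <= x)%R -> (x <= y)%R ->
  lne x%:E * ((ln n%:R)^-1)%:E <= lne y%:E * ((ln n%:R)^-1)%:E :> \bar R.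
Proof.
move=> x0 xy; apply: lee_wpmul2r.
  rewrite lee_fin invr_ge0; case: n => [|n]; first by rewrite ln0.
  by rewrite ln_ge0 // ler1n.
by rewrite lee_lne ?in_itv /= ?leey ?lee_fin ?(le_trans x0 xy) ?x0.
Qed.

Lemma log_growth_le (c d : nat) (u : nat -> nat) :
  (forall n, (0 < n)%N -> (u n <= c * n ^ d)%N) -> log_growth u <= d%:R%:E.
Proof.
move=> uc; rewrite -(@limn_log_poly c.+1%:R d) ?ltr0n //; apply: le_limn_esup_near.
exists 1%N => // n /= n0; apply: le_log_ratio; rewrite ?ler0n //.
rewrite -natrX -natrM ler_nat (leq_trans (uc n n0)) //.
by rewrite leq_mul2r leqnSn orbT.
Qed.

Lemma log_growth_ge (c d N : nat) (u : nat -> nat) : (0 < c)%N ->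
  (forall n, (N <= n)%N -> (n ^ d <= c * u n)%N) -> d%:R%:E <= log_growth u.
Proof.
move=> c0 uc; rewrite -(@limn_log_poly c%:R^-1 d) ?invr_gt0 ?ltr0n //.
apply: le_limn_esup_near; exists N => // n /= Nn; apply: le_log_ratio.
  by rewrite mulr_ge0 ?invr_ge0 ?exprn_ge0 ?ler0n.
by rewrite mulrC ler_pdivrMr ?ltr0n // -natrX -natrM ler_nat mulnC uc.
Qed.
End Growth.

Section Counting.
Local Open Scope nat_scope.

Lemma ffact_le_exp n k : n ^_ k <= n ^ k.
Proof.
have -> : n ^ k = \prod_(i < k) n by rewrite prod_nat_const card_ord.
rewrite ffact_prod.
by apply: leq_prod => i _; apply: leq_subr.
Qed.

(** For n >= 2k each of the k+1 factors of (n+1)n...(n+1-k) is at least n/2. *)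
Lemma exp_le_ffact n k : k.*2 <= n -> n ^ k.+1 <= 2 ^ k.+1 * n.+1 ^_ k.+1.
Proof.
move=> le_kn; have powE m : m ^ k.+1 = \prod_(i < k.+1) m by rewrite prod_nat_const card_ord.
rewrite ffact_prod !powE -big_split /=.
by apply: leq_prod => i _; move: (ltn_ord i) le_kn; lia.
Qed.

Lemma fact_homo : {homo factorial : m n / m <= n}.
Proof.
by apply: homo_leq => // [n m p /leq_trans|n]; [apply|rewrite factS leq_pmull].
Qed.

Lemma expn_homo e : {homo expn^~ e : m n / m <= n}.
Proof. by move=> m n le; case: e => // e; rewrite leq_exp2r. Qed.

Lemma sum_binl n k : \sum_(i < n) 'C(i, k) = 'C(n, k.+1).
Proof. by elim: n => [|n IHn]; rewrite ?big_ord0 // big_ord_recr /= IHn binS. Qed.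
End Counting.

Section GKdimBounds.
Variables (R : realType) (K : fieldType) (J : operad_ideal (Ass K)).
Let P := quotient_operad J.

Lemma GKdimE : GKdim R P =
  log_growth R (fun n => \sum_(i < n.+1) (dim (Ass K i) - \dim (J i)))%N.
Proof.
rewrite /GKdim /log_growth; congr limn_esup; apply/funext => n.
do 4 f_equal; apply: eq_bigr => i _; exact: dim_vquot.
Qed.

Lemma GKdim_le k : (0 < k)%N -> (forall n, (Upsilon K k n <= J n)%VS) ->
  (GKdim R P <= k%:R%:E)%E.
Proof.
move=> k0 UJ; rewrite GKdimE; apply: (@log_growth_le _ (2 * (k`! + 1))%N) => n n0.
have bound (i : 'I_n.+1) : (dim (Ass K i) - \dim (J i) <= (k`! + 1) * n ^ k.-1)%N.
  rewrite dim_Ass; have [lt_ik|le_ki] := ltnP i k.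
    apply: leq_trans (leq_subr _ _) _; apply: leq_trans (leq_pmulr _ _); last by rewrite expn_gt0 n0.
    by rewrite addn1 ltnW // ltnS fact_homo // ltnW.
  have k0i : (0 < k <= i)%N by rewrite k0.
  apply: leq_trans (leq_sub2l _ (dimvS (UJ i))) _.
  rewrite leq_subLR; apply: leq_trans (codim_Upsilon K k0i) _.
  rewrite leq_add2l bin_ffact; apply: leq_trans (ffact_le_exp _ _) _.
  apply: leq_trans (leq_pmull _ _); last by rewrite addn1.
  by rewrite expn_homo // -ltnS.
apply: (@leq_trans (\sum_(i < n.+1) (k`! + 1) * n ^ k.-1)%N).
  by apply: leq_sum => i _; apply: bound.
rewrite sum_nat_const card_ord -[X in (_ <= _ * n ^ X)%N](prednK k0) expnS.
by rewrite mulnACA leq_mul2r; apply/orP; right; lia.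
Qed.

Lemma GKdim_ge k (g : Ass K k) : is_proper g -> g \notin J k ->
  (k.+1%:R%:E <= GKdim R P)%E.
Proof.
move=> gP gJ; rewrite GKdimE.
apply: (@log_growth_ge _ ((k.+1)`! * 2 ^ k.+1)%N _ k.*2) => [|n le_kn].
  by rewrite muln_gt0 fact_gt0 expn_gt0.
apply: leq_trans (exp_le_ffact le_kn) _.
rewrite -bin_ffact (mulnC 'C(_, _)) mulnA (mulnC (2 ^ _)%N) leq_mul2l -sum_binl.
by apply/orP; right; apply: leq_sum => i _; apply: codim_lower gJ.
Qed.

End GKdimBounds.

(** * Proper polynomials in small arities *)

Section Coefficients.
Variable K : fieldType.

(** A permutation is determined by the position j of the letter i and the
    order of the other letters. *)
Lemma lift_perm_bij n (i : 'I_n.+1) :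
  bijective (fun p : 'I_n.+1 * 'S_n => lift_perm i p.1 p.2).
Proof.
apply: inj_card_bij => [[j s] [j' s'] /= E|]; last first.
  by rewrite card_prod card_ord !card_Sn factS.
have ej : j = j' by have := congr1 (fun p : 'S_n.+1 => p i) E; rewrite !lift_perm_id.
rewrite -{}ej in E *; congr pair; apply/permP => k; apply: (@lift_inj _ j).
by rewrite -!(lift_perm_lift i) E.
Qed.

(** A factor 1 may be left out of a noncommutative product. *)
Lemma prod_drop (A : nzRingType) n (j : 'I_n.+1) (F : 'I_n.+1 -> A) : F j = 1 ->
  \prod_(k < n.+1) F k = \prod_(k < n) F (lift j k).
Proof.
elim: n j F => [|n IHn] j F Fj.
  by rewrite big_ord1 big_ord0 -[RHS]Fj; congr F; rewrite !ord1.
have [j0|] := eqVneq ord0 j; first by subst j; rewrite big_ord_recl Fj mul1r.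
move=> /unlift_some[j' jE _]; rewrite big_ord_recl (IHn j'); last by rewrite -jE.
rewrite [RHS]big_ord_recl; congr (_ * _).
  by congr F; rewrite jE; apply: val_inj.
by apply: eq_bigr => k _; congr F; rewrite jE; apply: val_inj; rewrite /= /bump /= !add1n ltnS addnS.
Qed.

(** Setting the letter i to 1 in a proper polynomial gives 0; the coefficient of
    a monomial t in the other letters collects the monomials obtained by
    inserting i into t in all possible positions. *)
Lemma proper_coef n (x : Ass K n.+1) i (t : 'S_n) : is_proper x ->
  \sum_j x (lift_perm i j t) = 0.
Proof.
move=> xP; pose u k : 'M[K]_n.+1 := delta_mx (inord (t k)) (inord (t k).+1).
have ui : extend (lift i) u i = 1 by exact: extend_lift.
have E := congr1 (fun M : 'M[K]_n.+1 => M ord0 ord_max) (xP _ _ i ui).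
rewrite /= [RHS]mxE in E; apply: etrans E.
rewrite /ev (reindex _ (onW_bij _ (lift_perm_bij i))) /=.
rewrite -(pair_bigA _ (fun j s => x (lift_perm i j s) *:
   \prod_k extend (lift i) u ((lift_perm i j s)^-1%g k))) /= summxE.
apply: eq_bigr => j _; rewrite summxE.
have entry s : (\prod_k extend (lift i) u ((lift_perm i j s)^-1%g k)) ord0 ord_max = (t == s)%:R.
  rewrite (@prod_drop _ n j) lift_permV ?lift_perm_id //.
  under eq_bigr => k _ do rewrite lift_perm_lift (extend_in u _ (@lift_inj _ i)).
  by rewrite -ev_basis ev_matrix_units ffunE.
rewrite (bigD1 t) //= [X in _ + X]big1 ?addr0 => [|s ne]; rewrite mxE entry.
  by rewrite eqxx mulr1.
by rewrite eq_sym (negbTE ne) mulr0.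
Qed.

Lemma act_coef n (x : Ass K n) (t r : 'S_n) : operad_act x t r = x (t^-1 * r)%g.
Proof.
rewrite /= sum_ffunE (bigD1 (t^-1 * r)%g) //= [X in _ + X]big1 ?addr0 => [|s ne].
  by rewrite !ffunE mulKVg eqxx [LHS]mulr1.
rewrite !ffunE; case: eqP => [e|_]; last by rewrite [LHS]mulr0.
by case/eqP: ne; rewrite e mulKg.
Qed.

Lemma proper_act n (x : Ass K n) (t : 'S_n) : is_proper x -> is_proper (operad_act x t).
Proof. by move=> xP N a i ai; rewrite ev_act; apply: (xP _ _ (t i)); rewrite permK. Qed.

Lemma proper_coef_act n (x : Ass K n.+1) i (s : 'S_n.+1) : is_proper x ->
  \sum_j x (s * lift_perm i j 1)%g = 0.
Proof.
move=> xP; have := proper_coef i 1%g (@proper_act _ _ s^-1%g xP).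
by under eq_bigr do rewrite act_coef invgK.
Qed.

End Coefficients.
Section SmallArities.
Variable K : fieldType.

Lemma ev_ones (A : algType K) n (x : Ass K n) : ev x (fun=> 1 : A) = (\sum_s x s)%:A.
Proof.
by rewrite scaler_suml; apply: eq_bigr => s _; rewrite big1_eq.
Qed.

Lemma perm_small n (s : 'S_n) : (n <= 1)%N -> s = 1%g.
Proof.
case: n s => [|[|//]] s _; apply/permP => i; first by case: i.
by rewrite !ord1.
Qed.

Lemma sum_small n (x : Ass K n) : (n <= 1)%N -> \sum_s x s = x 1%g.
Proof.
move=> n1; rewrite (bigD1 1%g) //= [X in _ + X]big1 ?addr0 // => s /eqP ne.
by case: ne; apply: perm_small.
Qed.

Lemma proper1_eq0 (x : Ass K 1%N) : is_proper x -> x = 0.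
Proof.
move=> xP; apply/ffunP => s; rewrite (perm_small s) // ffunE.
by have := proper_coef ord0 1%g xP; rewrite big_ord1 lift_perm1.
Qed.

(** The relation of [proper_coef] makes the two coefficients opposite. *)
Lemma proper2_line (x y : Ass K 2%N) : is_proper x -> is_proper y -> x != 0 ->
  exists c, y = c *: x.
Proof.
move=> xP yP x0.
have perm2 (s : 'S_2) : exists j, s = lift_perm ord0 j 1%g.
  have [g _ gK] := lift_perm_bij (ord0 : 'I_2).
  by exists (g s).1; rewrite -[LHS]gK (perm_small (g s).2).
have coef (z : Ass K 2%N) : is_proper z -> forall j : 'I_2,
    z (lift_perm ord0 j 1)%g = (-1) ^+ j * z 1%g.
  move=> zP j; have := proper_coef ord0 1%g zP.
  rewrite big_ord_recl big_ord1 lift_perm1 => /eqP; rewrite addrC addr_eq0 => /eqP E.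
  have [->|] := eqVneq j ord0; first by rewrite lift_perm1 mul1r.
  rewrite eq_sym => /unlift_some[j' -> _]; rewrite (ord1 j') E.
  by rewrite expr1 mulN1r.
have x1 : x 1%g != 0.
  apply: contra_neq x0 => x1; apply/ffunP => s; have [j ->] := perm2 s.
  by rewrite coef // x1 mulr0 ffunE.
exists (y 1%g / x 1%g); apply/ffunP => s; have [j ->] := perm2 s.
by rewrite ffunE !coef // [RHS]mulrCA divfK.
Qed.

Lemma sum_ord3 (F : 'I_3 -> K) : \sum_i F i = F 0 + F 1 + F ord_max.
Proof.
by rewrite !big_ord_recl big_ord0 addr0 addrA; congr (_ + F _ + F _); apply: val_inj.
Qed.

(** Positions being numbered from 0, this is the letter in the middle of the
    monomial s. *)
Definition middle (s : 'S_3) : 'I_3 := (s^-1)%g 1%R.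

Definition of_middle (al : 'I_3 -> K) : Ass K 3%N := [ffun s => al (middle s)].

Lemma of_middleZB al be c (d : 'I_3 -> K) : (forall i, al i - be i = c * d i) ->
  of_middle al - of_middle be = c *: of_middle d.
Proof. by move=> E; apply/ffunP => s; rewrite !ffunE E. Qed.

Lemma of_middle_act al (t : 'S_3) : operad_act (of_middle al) t = of_middle (al \o t).
Proof. by apply/ffunP => s; rewrite act_coef !ffunE /middle invMg invgK permM. Qed.

(** The image of the third letter is what remains. *)
Lemma perm3_eq (s t : 'S_3) : s 0 = t 0 -> s 1 = t 1 -> s = t.
Proof.
move=> e0 e1.
have e2 : s ord_max = t ord_max.
  pose i := (t^-1)%g (s ord_max); have: t i = s ord_max by rewrite permKV.
  have : i \in [:: 0; 1; ord_max] by case: i => [[|[|[|]]]].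
  rewrite !inE => /or3P[] /eqP -> E //.
    by have := perm_inj (etrans e0 E).
  by have := perm_inj (etrans e1 E).
apply/permP => k; have : k \in [:: 0; 1; ord_max] by case: k => [[|[|[|]]]].
by rewrite !inE => /or3P[] /eqP ->.
Qed.

(** Write abc for the coefficient of the monomial x_a x_b x_c.  Inserting c into ab
    gives abc + acb + cab = 0, inserting a into cb gives acb + cab + cba = 0,
    hence abc = cba: coefficients depend only on the letter in the middle, and
    each relation says that they add up to 0. *)
Lemma proper3_middle (x : Ass K 3%N) : is_proper x ->
  exists2 al : 'I_3 -> K, x = of_middle al & \sum_i al i = 0.
Proof.
move=> xP.
have R1 s := proper_coef_act ord_max s xP.
have R2 s := proper_coef_act ord0 s xP.
have l0 : lift ord_max (ord0 : 'I_2) = 0 :> 'I_3 by apply: val_inj.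
have l1 : lift ord_max (ord_max : 'I_2) = 1 :> 'I_3 by apply: val_inj.
have l1' : lift ord0 (ord0 : 'I_2) = 1 :> 'I_3 by apply: val_inj.
have l2' : lift ord0 (ord_max : 'I_2) = ord_max :> 'I_3 by apply: val_inj.
have k10 : lift (1 : 'I_3) ord0 = 0 by apply: val_inj.
have k12 : lift (1 : 'I_3) ord_max = ord_max by apply: val_inj.
have k00 : lift (0 : 'I_3) ord0 = 1 by apply: val_inj.
have k02 : lift (0 : 'I_3) ord_max = ord_max by apply: val_inj.
have c0 (j : 'I_3) : lift_perm ord_max j 1%g 0 = lift j ord0 by rewrite -l0 lift_perm_lift perm1.
have c1 (j : 'I_3) : lift_perm ord_max j 1%g 1 = lift j ord_max by rewrite -l1 lift_perm_lift perm1.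
have b0 (j : 'I_3) : lift_perm ord0 j 1%g 0 = j by rewrite lift_perm_id.
have b1 (j : 'I_3) : lift_perm ord0 j 1%g 1 = lift j ord0 by rewrite -l1' lift_perm_lift perm1.
have b2 (j : 'I_3) : lift_perm ord0 j 1%g ord_max = lift j ord_max.
  by rewrite -l2' lift_perm_lift perm1.
(* Reading a monomial backwards. *)
pose rev : 'S_3 := tperm 0 ord_max.
have xrev s : x (s * rev)%g = x s.
  have := R2 (s * lift_perm ord_max 1%R 1)%g; have := R1 s.
  rewrite !sum_ord3 !lift_perm1 !mulg1 -!mulgA.
  have -> : (lift_perm ord_max 1%R 1 * lift_perm ord0 1%R 1 = lift_perm ord_max 0%R 1 :> 'S_3)%g.
    by apply: perm3_eq; rewrite permM ?c0 ?c1 ?k10 ?k12 ?b0 ?b2 ?k00 ?k12 ?k02.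
  have -> : (lift_perm ord_max 1%R 1 * lift_perm ord0 ord_max 1 = rev :> 'S_3)%g.
    by apply: perm3_eq; rewrite permM ?c0 ?c1 ?k10 ?k12 ?b0 ?b2 ?l1 /rev ?tpermL // tpermD.
  move/eqP; rewrite addrC addr_eq0 => /eqP -> /eqP.
  by rewrite addrC addr_eq0 => /eqP ->; rewrite addrC.
have xmid s t : middle s = middle t -> x s = x t.
  move=> e; have q1 : (t^-1 * s)%g 1%R = 1%R by rewrite permM -/(middle t) -e permKV.
  have -> : s = (t * (t^-1 * s))%g by rewrite mulKVg.
  move: (t^-1 * s)%g q1 => q q1.
  have : q 0 \in [:: 0; 1; ord_max] by case: (q 0) => [[|[|[|]]]].
  rewrite !inE => /or3P[] /eqP q0.
  - by rewrite (_ : q = 1%g) ?mulg1 //; apply: perm3_eq; rewrite perm1.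
  - by have := perm_inj (etrans q0 (esym q1)).
  rewrite -(xrev t); congr (x (t * _)%g); apply: perm3_eq; rewrite /rev ?tpermL //.
  by rewrite tpermD.
exists (fun i => x (tperm i 1)).
  apply/ffunP => s; rewrite ffunE; apply: xmid.
  by rewrite /middle tpermV tpermR.
have := R1 1%g; rewrite !sum_ord3 !mul1g => <-.
rewrite -!addrA; congr (_ + _).
  apply: xmid; rewrite /middle tpermV tpermR.
  rewrite -[LHS](permK (lift_perm ord_max 0 1%g)); congr (fun_of_perm _ _).
  by rewrite c0; apply: val_inj.
rewrite addrC; congr (_ + _); apply: xmid; rewrite /middle tpermV tpermR.
  by rewrite -[LHS](permK (lift_perm ord_max 1%R 1%g)) lift_perm_id.
by rewrite lift_perm1 invg1 perm1.
Qed.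

(** If al takes different values at i and j, then x minus its image under the
    transposition of i and j is a nonzero multiple of the difference of the
    indicators of i and j, and the translates of this difference span all
    functions of sum zero.  A constant al with 3 al = 0 must vanish. *)
Lemma ideal3_irreducible (J : operad_ideal (Ass K)) (x y : Ass K 3%N) : 3%:R != 0 :> K ->
  is_proper x -> x != 0 -> x \in J 3%N -> is_proper y -> y \in J 3%N.
Proof.
move=> char3 /proper3_middle[al -> al0] x0 xJ /proper3_middle[be -> be0].
have [i [j [ij alij]]] : exists i j, i != j /\ al i != al j.
  apply: contrapT => H; have al1 i : al i = al 1.
    apply: contrapT => /eqP ne; apply: H; exists i, 1; split=> //.
    by apply: contra_neq ne => ->.
  case/eqP: x0; apply/ffunP => s; rewrite !ffunE al1.
  move/eqP: al0; under eq_bigr do rewrite al1.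
  by rewrite sumr_const card_ord -mulr_natl mulf_eq0 (negbTE char3) => /eqP.
pose de k l (m : 'I_3) : K := (m == k)%:R - (m == l)%:R.
have dJ : of_middle (de i j) \in J 3%N.
  have E : of_middle al - of_middle (al \o tperm i j) = (al i - al j) *: of_middle (de i j).
    apply: of_middleZB => m; rewrite /de /=.
    case: tpermP => [->|->|/eqP/negbTE -> /eqP/negbTE ->].
    - by rewrite eqxx (negbTE ij) subr0 mulr1.
    - by rewrite eqxx eq_sym (negbTE ij) sub0r mulrN1 opprB.
    - by rewrite !subrr mulr0.
  have := memvZ (al i - al j)^-1 (memvB xJ (ideal_act (tperm i j) xJ)).
  by rewrite of_middle_act E scalerA mulVf ?subr_eq0 // scale1r.
have dJ' k : k != 1 -> of_middle (de k 1) \in J 3%N.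
  move=> k1; pose t1 := tperm k i; pose t := (t1 * tperm (t1 1%R) j)%g.
  have tk : t k = i.
    rewrite permM tpermL tpermD // 1?eq_sym //.
    by rewrite -[X in X != _](tpermL k i) (inj_eq perm_inj).
  have t1' : t 1 = j by rewrite permM tpermL.
  have := ideal_act t dJ; rewrite of_middle_act.
  suff -> : de i j \o t = de k 1 by [].
  by apply/funext => m; rewrite /de /= -tk -t1' !(inj_eq perm_inj).
have -> : of_middle be = \sum_(k | k != 1) be k *: of_middle (de k 1).
  apply/ffunP => s; rewrite sum_ffunE ffunE.
  under eq_bigr do rewrite !ffunE /de.
  move: (middle s) => m; have [->|m1] := eqVneq m 1.
    under eq_bigr => k k1 do rewrite eq_sym (negbTE k1) sub0r [_ *: _]mulrN1.
    by move/eqP: be0; rewrite (bigD1 1) //= sumrN addr_eq0 => /eqP.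
  rewrite (bigD1 m) //= [X in _ + X]big1 ?addr0 => [|k /andP[_ km]].
    by rewrite eqxx subr0 [RHS]mulr1.
  by rewrite eq_sym (negbTE km) subr0 [LHS]mulr0.
by apply: memv_suml => k k1; apply: memvZ; apply: dJ'.
Qed.
End SmallArities.

(** * Commutators and small components of an ideal *)

Section Commutators.
Variable K : fieldType.

(** The commutator of x with a new letter, which becomes the last one. *)
Lemma commutator n (x : Ass K n) :
  exists w : Ass K n.+1,
    (forall (A : algType K) (b : 'I_n.+1 -> A),
       ev w b = ev x (b \o lift ord_max) * b ord_max - b ord_max * ev x (b \o lift ord_max)) /\
    (forall J : operad_ideal (Ass K), x \in J n -> w \in J n.+1).
Proof.
have [u [uE uJ]] := juxtapose x (ass_id K 1).
have [v [vE vJ]] := juxtapose (ass_id K 1) x.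
have [u' [uE' uJ']] := relabel u (esym (addn1 n)) (@cast_ord_inj _ _ (esym (addn1 n))).
exists (u' - operad_act (v : Ass K n.+1) (lift_perm ord_max ord0 1%g)); split=> [A b|J xJ].
  rewrite evB; congr (_ - _).
    rewrite (@eq_ev _ _ _ u' b ((b \o cast_ord (addn1 n)) \o cast_ord (esym (addn1 n)))).
      rewrite uE' uE ev_id big_ord1; congr (_ * _); last by congr b; apply: val_inj; rewrite /= addn0.
      by apply: eq_ev => i /=; congr b; apply: val_inj; rewrite /= /bump leqNgt ltn_ord.
    by move=> i /=; rewrite cast_ordKV.
  rewrite ev_act lift_permV invg1 vE ev_id big_ord1; congr (_ * _).
    by rewrite /= (_ : lshift n ord0 = ord0) ?lift_perm_id //; apply: val_inj.
  apply: eq_ev => i; rewrite /= (_ : rshift 1 i = lift ord0 i) ?lift_perm_lift ?perm1 //.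
  exact: val_inj.
by apply: memvB; [apply/uJ'/uJ; left|apply/ideal_act/vJ; right].
Qed.

(** It is enough that x becomes a scalar when a letter is set to 1; this covers
    both proper x and a single letter. *)
Lemma commutator_proper n (x : Ass K n) (w : Ass K n.+1) :
    (forall (A : algType K) (b : 'I_n.+1 -> A),
       ev w b = ev x (b \o lift ord_max) * b ord_max - b ord_max * ev x (b \o lift ord_max)) ->
    (forall N (a : 'I_n -> 'M[K]_N.+1) i, a i = 1 -> exists c, ev x a = c%:A) ->
  is_proper w.
Proof.
move=> wE xP N a i; rewrite wE; have [->|] := eqVneq i ord_max.
  by move=> ->; rewrite mulr1 mul1r subrr.
rewrite eq_sym => /unlift_some[k -> _] ak; have [c ->] := xP N (a \o lift ord_max) k ak.
by rewrite -scalerAl -scalerAr mulr1 mul1r subrr.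
Qed.

Lemma iterated_commutators :
  exists (c2 : Ass K 2%N) (c3 : Ass K 3%N) (c4 : Ass K 4%N),
  [/\ [/\ is_proper c2, is_proper c3 & is_proper c4],
      forall (A : algType K) (b : nat -> A), ev c2 b = b 0%N * b 1%N - b 1%N * b 0%N,
      forall (A : algType K) (b : nat -> A), ev c3 b = ev c2 b * b 2%N - b 2%N * ev c2 b,
      forall (A : algType K) (b : nat -> A), ev c4 b = ev c3 b * b 3%N - b 3%N * ev c3 b
    & forall J : operad_ideal (Ass K), c2 \in J 2%N -> c3 \in J 3%N].
Proof.
have [c2 [c2E _]] := commutator (ass_id K 1).
have [c3 [c3E c3J]] := commutator c2.
have [c4 [c4E _]] := commutator c3.
have lastP n (A : algType K) (x : Ass K n) (b : nat -> A) :
    ev x ((b : 'I_n.+1 -> A) \o lift ord_max) = ev x b.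
  by apply: eq_ev => i; rewrite /= /bump leqNgt ltn_ord.
have c2P : is_proper c2.
  apply: commutator_proper c2E _ => N a i ai; exists 1.
  by rewrite ev_id big_ord1 scale1r -ai; congr a; apply: val_inj; case: i {ai} => -[].
have prop n (x : Ass K n) : is_proper x -> forall N (a : 'I_n -> 'M[K]_N.+1) i, a i = 1 ->
    exists c, ev x a = c%:A.
  by move=> xP N a i ai; exists 0; rewrite scale0r; apply: xP ai.
have c3P := commutator_proper c3E (prop _ _ c2P).
have c4P := commutator_proper c4E (prop _ _ c3P).
exists c2, c3, c4; split=> // A b.
- by rewrite c2E lastP ev_id big_ord1.
- by rewrite c3E lastP.
- by rewrite c4E lastP.
Qed.
End Commutators.

Section IdealArities.
Variables (K : fieldType) (J : operad_ideal (Ass K)).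

(** A nonzero constant in an ideal is invertible. *)
Lemma ideal0_full (x : Ass K 0%N) : x != 0 -> x \in J 0%N -> forall n, J n = fullv.
Proof.
move=> x0 xJ n; apply/eqP; rewrite eqEsubv subvf; apply/subvP => z _.
have [y [yE yJ]] := juxtapose z x.
have [y' [yE' yJ']] := relabel y (esym (addn0 n)) (@cast_ord_inj _ _ (esym (addn0 n))).
have xc : x 1%g != 0.
  apply: contra_neq x0 => x1; apply/ffunP => s; by rewrite (perm_small s) // x1 ffunE.
suff <- : (x 1%g)^-1 *: y' = z by apply/memvZ/yJ'/yJ; right.
apply: (@ev_inj K) => N a; rewrite evZ.
have aE : a =1 (a \o cast_ord (addn0 n)) \o cast_ord (esym (addn0 n)).
  by move=> i /=; rewrite cast_ordKV.
rewrite (eq_ev y' aE).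
rewrite yE' yE (@eq_ev _ _ _ x _ (fun=> 1)); last by case.
rewrite ev_ones (sum_small x) // -scalerAr mulr1 scalerA mulVf // scale1r.
by apply: eq_ev => i /=; congr a; apply: val_inj.
Qed.

(** The truncations that forget one letter are in J n, which is 0. *)
Lemma ideal_proper n (x : Ass K n.+1) : J n = 0%VS -> x \in J n.+1 -> is_proper x.
Proof.
move=> Jn xJ N a i ai; have [y [yE yJ]] := restrict x (@lift_inj _ i).
have y0 : y = 0 by apply/eqP; rewrite -memv0 -Jn; apply: yJ.
rewrite (@eq_ev _ _ _ x _ (extend (lift i) (a \o lift i))); first by rewrite -yE y0 ev0.
move=> j; have [->|] := eqVneq j i; first by rewrite extend_lift.
by rewrite eq_sym => /unlift_some[k -> _]; rewrite extend_in //; apply: lift_inj.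
Qed.

Lemma ideal_sub_Upsilon k : (0 < k)%N -> (forall m, (m < k)%N -> J m = 0%VS) ->
  forall n, (J n <= Upsilon K k n)%VS.
Proof.
move=> k0 J0 n; have [lt_nk|le_kn] := ltnP n k; first by rewrite J0 // sub0v.
apply/subvP => x xJ; apply/(mem_Upsilon_vanish _ le_kn) => S cS N a aS.
have [y [yE yJ]] := restrict x (@enum_val_inj _ (mem S)).
have y0 : y = 0.
  by apply/eqP; rewrite -memv0 -(J0 #|S|) ?cS ?prednK //; apply: yJ.
rewrite (@eq_ev _ _ _ x _ (extend enum_val (a \o @enum_val _ (mem S)))); first by rewrite -yE y0 ev0.
move=> i; have [iS|iS] := boolP (i \in S); last first.
  by rewrite aS // extend_out //; apply: contra iS => /codomP[j ->]; apply: enum_valP.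
by rewrite -(enum_rankK_in iS iS) extend_in //; apply: enum_val_inj.
Qed.

Lemma ideal_eq_Upsilon k : (0 < k)%N -> (forall m, (m < k)%N -> J m = 0%VS) ->
    (forall m (x : Ass K m), (k <= m)%N -> is_proper x -> x \in J m) ->
  forall n, J n = Upsilon K k n.
Proof.
move=> k0 J0 JP n; apply/eqP; rewrite eqEsubv ideal_sub_Upsilon //.
exact: Upsilon_sub.
Qed.
End IdealArities.

Section Commutative.
Variable K : fieldType.

Let coef_sum n (x : Ass K n) : K^o := \sum_s x s.

Lemma ev_comm (A : comAlgType K) n (x : Ass K n) (a : 'I_n -> A) :
  ev x a = (\sum_s x s) *: \prod_i a i.
Proof.
rewrite scaler_suml; apply: eq_bigr => s _; congr (_ *: _).
by rewrite [RHS](reindex_inj (@perm_inj _ s^-1%g)).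
Qed.

(** The isomorphism is the sum of the coefficients: it is evaluation at 1 in K,
    hence a morphism by [ev_comp], and its kernel is Upsilon 1 in positive
    arities and 0 in arity 0. *)
Lemma quotient_Upsilon1_Com (J : operad_ideal (Ass K)) :
  (forall n, J n = Upsilon K 1 n) -> operad_isomorphic (quotient_operad J) (Com K).
Proof.
move=> JU; pose P := quotient_operad J.
have cs_lin n : linear (@coef_sum n).
  move=> c x y; rewrite /coef_sum scaler_sumr -big_split.
  by apply: eq_bigr => s _; rewrite !ffunE.
have cs_id n : coef_sum (ass_id K n) = 1.
  rewrite /coef_sum (bigD1 1%g) //= big1 ?addr0 => [|s ne]; rewrite ffunE ?eqxx //.
  by rewrite (negbTE ne).
have csB n (x y : Ass K n) : coef_sum (x - y) = coef_sum x - coef_sum y.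
  by rewrite addrC -scaleN1r (cs_lin n) scaleN1r addrC.
have csZ n c : coef_sum (c *: ass_id K n) = c.
  rewrite -[X in coef_sum X]addr0 (cs_lin n) cs_id [_ *: _]mulr1.
  by rewrite /coef_sum big1 ?addr0 // => s _; rewrite ffunE.
have evcs n (x : Ass K n) : ev x (fun=> 1 : K^o) = coef_sum x.
  by rewrite ev_ones [LHS]mulr1.
have memJ n (x : Ass K n) : (x \in J n) = (coef_sum x == 0).
  rewrite JU; case: n x => [|n] x.
    rewrite memv0 /coef_sum sum_small //; apply/eqP/eqP => [->|x1]; first by rewrite ffunE.
    by apply/ffunP => s; rewrite (perm_small s) // x1 ffunE.
  apply/idP/eqP => [/(mem_Upsilon_vanish x (ltn0Sn n)) H|x0]; last first.
    apply/(mem_Upsilon_vanish x (ltn0Sn n)) => S /eqP.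
    rewrite cards_eq0 => /eqP -> N a a1.
    rewrite (@eq_ev _ _ _ x _ (fun=> 1)); last by move=> i; apply: a1; rewrite inE.
    by rewrite ev_ones -/(coef_sum x) x0 scale0r.
  have := H set0 (cards0 _) 0%N (fun=> 1) (fun _ _ => erefl).
  rewrite ev_ones => /matrixP/(_ 0 0); rewrite !mxE eqxx [_ * _]mulr1 => E.
  exact: E.
pose F n (q : P n) : Com K n := coef_sum (generic_quotient.repr q).
have FE n (x : Ass K n) : F n (vquot_pi (J n) x) = coef_sum x.
  by apply/eqP; rewrite -subr_eq0 -csB -memJ vquot_repr_pi.
have piF n (q : P n) : q = vquot_pi (J n) (generic_quotient.repr q) by rewrite vquot_reprK.
exists F; split; [split|].
- move=> n a x y; rewrite (piF n x) (piF n y) -linearP !FE; exact: cs_lin.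
- move=> n x s; rewrite (piF n x) -quotient_pi_act !FE -!evcs ev_act.
  by apply: eq_ev.
- by apply: etrans (FE 1%N (ass_id K 1)) _; rewrite cs_id.
- move=> n m x ys.
  apply: etrans (FE _ _) _; rewrite -evcs ev_comp.
  rewrite (@eq_ev _ _ _ _ _ (fun i => F (m i) (ys i) : K^o)); last by move=> i; rewrite evcs.
  by rewrite ev_comm.
move=> n; exists (fun c : K^o => vquot_pi (J n) (c *: ass_id K n)) => [q|c].
  by rewrite [RHS]piF; apply/eqP; rewrite eq_vquot_pi memJ csB csZ subrr.
by rewrite FE csZ.
Qed.
End Commutative.

(** * Quotients of small growth *)

Section MatrixUnits.
Variables (K : fieldType) (n : nat).

Definition munit (i j : nat) : 'M[K]_n.+1 := delta_mx (inord i) (inord j).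

Lemma munitM i j k l : (j <= n)%N -> (k <= n)%N ->
  munit i j * munit k l = if j == k then munit i l else 0.
Proof.
move=> jn kn; rewrite /munit -[_ * _]/(_ *m _) mul_delta_mx_cond -val_eqE /= !inordK //.
by case: eqP; rewrite ?mulr1n ?mulr0n.
Qed.

Lemma munit_neq0 i j : munit i j != 0.
Proof.
apply/eqP => /matrixP/(_ (inord i) (inord j)); rewrite !mxE !eqxx => /eqP.
by rewrite oner_eq0.
Qed.
End MatrixUnits.

Section SmallGrowth.
Variables (R : realType) (K : fieldType) (J : operad_ideal (Ass K)).
Let d := GKdim R (quotient_operad J).

Lemma proper_in_ideal k : (d < k.+1%:R%:E)%E ->
  forall m (x : Ass K m), (k <= m)%N -> is_proper x -> x \in J m.
Proof.
move=> dk m x km xP; apply: contraTT dk => xJ; rewrite -leNgt.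
by apply: le_trans (GKdim_ge R xP xJ); rewrite lee_fin ler_nat ltnS.
Qed.

Lemma GKdim_le_proper k : (0 < k)%N ->
    (forall m (x : Ass K m), (k <= m)%N -> is_proper x -> x \in J m) ->
  (d <= k%:R%:E)%E.
Proof. by move=> k0 JP; apply: GKdim_le => // n; apply: Upsilon_sub. Qed.

(** Otherwise the quotient is the zero operad, whose GKdim is -oo. *)
Lemma ideal0_eq0 : (0 < d)%E -> J 0%N = 0%VS.
Proof.
move=> d0; apply/eqP; rewrite -subv0; apply/subvP => x xJ; rewrite memv0.
apply: contraTT d0 => x0; rewrite -leNgt /d GKdimE.
apply: (@log_growth_le R 0 0) => n _; rewrite big1 // => i _.
by rewrite (ideal0_full x0 xJ) dimvf subnn.
Qed.

Lemma ideal1_eq0 : J 0%N = 0%VS -> J 1%N = 0%VS.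
Proof.
move=> J0; apply/eqP; rewrite -subv0; apply/subvP => x xJ; rewrite memv0.
by apply/eqP/proper1_eq0; apply: ideal_proper xJ.
Qed.

Lemma proper1_in (x : Ass K 1%N) : is_proper x -> x \in J 1%N.
Proof. by move=> /proper1_eq0 ->; apply: mem0v. Qed.

Lemma proper_in_1 : (forall m (x : Ass K m), (2 <= m)%N -> is_proper x -> x \in J m) ->
  forall m (x : Ass K m), (1 <= m)%N -> is_proper x -> x \in J m.
Proof.
by move=> H [//|[|m]] x _; [apply: proper1_in|apply: H].
Qed.

(** GKdim < 3 puts all proper polynomials of arity at least 2 into J, and in
    arity 1 there is only 0. *)
Lemma GKdim_lt3 : (d < 3%:R%:E)%E ->
  (d <= 1%:R%:E)%E /\ ((0 < d)%E -> forall n, J n = Upsilon K 1 n).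
Proof.
move=> d3; have JP := proper_in_1 (proper_in_ideal d3).
split=> [|d0]; first exact: GKdim_le_proper.
by apply: ideal_eq_Upsilon => // -[] // _; apply: ideal0_eq0.
Qed.

(** If J contained a nonzero element of arity k, it would contain all proper
    polynomials of arity at least k, by the irreducibility assumption in arity
    k and by growth in larger arities, so that GKdim would be at most k. *)
Lemma ideal_eq0_step k : (0 < k)%N -> (d < k.+2%:R%:E)%E -> (k%:R%:E < d)%E -> J k.-1 = 0%VS ->
  (forall x y : Ass K k, is_proper x -> x != 0 -> x \in J k -> is_proper y -> y \in J k) ->
  J k = 0%VS.
Proof.
move=> k0 dk2 dk Jk irr; apply/eqP; rewrite -subv0; apply/subvP => x xJ; rewrite memv0.
apply: contraTT dk => x0; rewrite -leNgt; apply: GKdim_le_proper => // m y.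
have xP : is_proper x by case: k k0 {dk2 irr} x Jk xJ x0 => // k _ x Jk xJ _; apply: ideal_proper xJ.
rewrite leq_eqVlt => /orP[/eqP e|km yP]; last exact: (proper_in_ideal dk2).
by subst m; apply: irr xP x0 xJ.
Qed.

Lemma ideal2_eq0 : (2%:R%:E < d)%E -> J 1%N = 0%VS -> (d < 4%:R%:E)%E -> J 2%N = 0%VS.
Proof.
move=> d2 J1 d4; apply: ideal_eq0_step => // x y xP x0 xJ yP.
by have [c ->] := proper2_line xP yP x0; apply: memvZ.
Qed.
End SmallGrowth.

Section Main.
Variables (R : realType) (K : fieldType) (J : operad_ideal (Ass K)).
Let d := GKdim R (quotient_operad J).

Lemma GKdim3_Upsilon : d = 3%:E -> forall n, J n = Upsilon K 3 n.
Proof.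
move=> d3; have lt a b : (a < b)%N -> (a%:R%:E < b%:R%:E :> \bar R)%E.
  by move=> ab; rewrite lte_fin ltr_nat.
have J0 : J 0%N = 0%VS by apply: (@ideal0_eq0 R); rewrite -/d d3 (lt 0 3)%N.
have J1 := ideal1_eq0 J0.
have J2 : J 2%N = 0%VS by apply: (@ideal2_eq0 R) => //; rewrite -/d d3 (lt _ _).
apply: ideal_eq_Upsilon => // [[|[|[|]]] //|].
by apply: (@proper_in_ideal R); rewrite -/d d3 (lt 3 4)%N.
Qed.

Lemma commutator3_neq0 (c2 : Ass K 2%N) (c3 : Ass K 3%N) :
  (forall (A : algType K) (b : nat -> A), ev c2 b = b 0%N * b 1%N - b 1%N * b 0%N) ->
  (forall (A : algType K) (b : nat -> A), ev c3 b = ev c2 b * b 2%N - b 2%N * ev c2 b) ->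
  c3 != 0.
Proof.
move=> c2E c3E; apply/eqP => c30; have := munit_neq0 K 2 0 2; case/eqP.
pose b := nth 0 [:: munit K 2 0 1; munit K 2 1 2; munit K 2 2 2].
rewrite -(@ev0 K _ 3%N (fun i => b i)) -c30 c3E c2E /b /=.
by rewrite !munitM //= subr0 !munitM //= subr0.
Qed.

(** In arity 2, J contains either no proper polynomial or all of them; in the
    second case it contains [[x1,x2],x3], hence all proper polynomials of
    arity 3, which makes GKdim at most 3. *)
Lemma GKdim4_Upsilon : 3%:R != 0 :> K -> d = 4%:E -> forall n, J n = Upsilon K 4 n.
Proof.
move=> char3 d4; have lt a b : (a < b)%N -> (a%:R%:E < b%:R%:E :> \bar R)%E.
  by move=> ab; rewrite lte_fin ltr_nat.
have J0 : J 0%N = 0%VS by apply: (@ideal0_eq0 R); rewrite -/d d4 (lt 0 4)%N.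
have J1 := ideal1_eq0 J0.
have irr (x y : Ass K 3%N) : is_proper x -> x != 0 -> x \in J 3%N -> is_proper y -> y \in J 3%N.
  exact: ideal3_irreducible.
have J2 : J 2%N = 0%VS.
  apply/eqP; rewrite -subv0; apply/subvP => x xJ; rewrite memv0; apply/eqP.
  have xP := ideal_proper J1 xJ; apply: contrapT => /eqP x0.
  have [c2 [c3 [c4 [[c2P c3P _] c2E c3E _ cJ]]]] := iterated_commutators K.
  have c3J : c3 \in J 3%N.
    by apply: cJ; have [c ->] := proper2_line xP c2P x0; apply: memvZ.
  have : (d <= 3%:R%:E)%E.
    apply: GKdim_le_proper => // m y; rewrite leq_eqVlt => /orP[/eqP e|km yP].
      by subst m; apply: irr c3J; rewrite ?(commutator3_neq0 c2E c3E).
    by apply: (@proper_in_ideal R _ _ 4); rewrite // -/d d4 (lt 4 5)%N.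
  by rewrite d4 leNgt (lt 3 4)%N.
have J3 : J 3%N = 0%VS by apply: (@ideal_eq0_step R) => //; rewrite -/d d4 (lt _ _).
apply: ideal_eq_Upsilon => // [[|[|[|[|]]]] //|].
by apply: (@proper_in_ideal R); rewrite -/d d4 (lt 4 5)%N.
Qed.

Lemma GKdim1_Com : d = 1%:E ->
  (forall n, J n = Upsilon K 1 n) /\ operad_isomorphic (quotient_operad J) (Com K).
Proof.
move=> d1; have d3 : (d < 3%:R%:E)%E by rewrite d1 lte_fin (ltr_nat _ 1 3).
have [_ JU] := GKdim_lt3 d3.
have {}JU : forall n, J n = Upsilon K 1 n by apply: JU; rewrite -/d d1 lte_fin ltr01.
by split=> //; apply: quotient_Upsilon1_Com.
Qed.

Lemma GKdim_gap : ~ (1%:E < d < 3%:E)%E.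
Proof.
by move=> /andP[d1 d3]; have [] := GKdim_lt3 d3; rewrite leNgt d1.
Qed.
End Main.

(** * Two quotients of dimension five *)

Section Identities.
Variable K : fieldType.

(** A subspace contained in P of maximal dimension is all of P. *)
Lemma vspace_of_submod (V : vectType K) (P : V -> Prop) :
  P 0 -> (forall c x y, P x -> P y -> P (c *: x + y)) ->
  exists U : {vspace V}, forall x, x \in U <-> P x.
Proof.
move=> P0 PD.
suff main k : forall U : {vspace V}, (dim V <= \dim U + k)%N -> (forall x, x \in U -> P x) ->
    exists U : {vspace V}, forall x, x \in U <-> P x.
  apply: (main (dim V) 0%VS); first by rewrite leq_addl.
  by move=> x; rewrite memv0 => /eqP ->.
elim: k => [|k IHk] U dU UP.
  exists U => x; split=> [/UP //|_].
  suff -> : U = fullv by apply: memvf.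
  by apply/eqP; rewrite eqEdim subvf dimvf -[X in (_ <= X)%N]addn0.
have [H|/existsNP[x /not_implyP[Px /negP xU]]] := pselect (forall x, P x -> x \in U).
  by exists U => x; split=> [/UP|/H].
apply: (IHk (U + <[x]>)%VS) => [|y /memv_addP[u uU [_ /vlineP[c ->] ->]]].
  have x0 : x != 0 by apply: contraNneq xU => ->; apply: mem0v.
  rewrite dimv_disjoint_sum ?dim_vline ?x0 -?addnA //.
  apply/eqP; rewrite -subv0; apply/subvP => y; rewrite memv_cap => /andP[yU /vlineP[c yc]].
  rewrite memv0 yc scaler_eq0 (negbTE x0) orbF; apply: contraNT xU => c0.
  by have := memvZ c^-1 yU; rewrite yc scalerA mulVf // scale1r.
by rewrite addrC; apply: PD => //; apply: UP.
Qed.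

Section Ideal.
Variables (A : algType K) (S : A -> Prop).
Hypotheses (S1 : S 1) (SZD : forall c x y, S x -> S y -> S (c *: x + y))
  (SM : forall x y, S x -> S y -> S (x * y)).

Lemma subalg_ev n (x : Ass K n) (a : 'I_n -> A) : (forall i, S (a i)) -> S (ev x a).
Proof.
move=> Sa; have S0 : S 0 by have := SZD (-1) S1 S1; rewrite scaleN1r addNr.
rewrite /ev; elim/big_rec: _ => // s y _ Sy; apply: SZD => //.
by elim/big_rec: _ => // k z _ Sz; apply: SM.
Qed.

Lemma identities_ideal : exists J : operad_ideal (Ass K),
  forall n (x : Ass K n), x \in J n <-> forall a, (forall i, S (a i)) -> ev x a = 0.
Proof.
have exU n : exists U : {vspace Ass K n},
    forall x, x \in U <-> forall a, (forall i, S (a i)) -> ev x a = 0.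
  apply: vspace_of_submod => [a _|c x y Hx Hy a Sa]; first exact: ev0.
  by rewrite ev_linear Hx ?Hy ?scaler0 ?addr0.
pose U n := sval (cid (exU n)); have UP n : forall x, x \in U n <-> _ := svalP (cid (exU n)).
have Uact n (x : Ass K n) (s : 'S_n) : x \in U n -> operad_act x s \in U n.
  by move=> /UP Hx; apply/UP => a Sa; rewrite ev_act Hx.
have Ucomp n (m : 'I_n -> nat) (x : Ass K n) (ys : forall i, Ass K (m i)) :
    x \in U n \/ (exists i, ys i \in U (m i)) -> operad_comp x ys \in U (\sum_i m i)%N.
  move=> Hxy; apply/UP => a Sa; rewrite ev_comp.
  case: Hxy => [/UP ->//|[i /UP Hi]]; first by move=> i; apply: subalg_ev.
  by apply: (@ev_eq0 _ _ _ _ i); apply: Hi.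
by exists (OperadIdeal Uact Ucomp).
Qed.
End Ideal.
End Identities.

Section TriangularMatrices.
Variables (K : fieldType) (n : nat).
Local Notation M := 'M[K]_n.+1.

Definition const_triangular (a : M) : Prop :=
  exists c, forall i j : 'I_n.+1, (j <= i)%N -> a i j = c *+ (i == j).

Lemma const_triangular1 : const_triangular 1.
Proof. by exists 1 => i j _; rewrite mxE. Qed.

Lemma const_triangularZD c a b : const_triangular a -> const_triangular b ->
  const_triangular (c *: a + b).
Proof.
move=> [ca aE] [cb bE]; exists (c * ca + cb) => i j ij.
by rewrite !mxE aE // bE // mulrnDl mulrnAr.
Qed.

Lemma const_triangularM a b : const_triangular a -> const_triangular b ->
  const_triangular (a * b).
Proof.
move=> [ca aE] [cb bE]; exists (ca * cb) => i j ij.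
rewrite !mxE (bigD1 i) //= big1 ?addr0 => [|k ki].
  by rewrite aE // eqxx mulr1n bE // mulrnAr.
have [ki'|ik] := ltnP k i.
  by rewrite aE 1?ltnW // eq_sym (negbTE ki) mulr0n mul0r.
have kj : (j < k)%N by apply: leq_ltn_trans ij _; rewrite ltn_neqAle eq_sym ki.
by rewrite bE 1?ltnW // -val_eqE /= gtn_eqF // mulr0n mulr0.
Qed.

Lemma const_triangular_munit i j : (i < j <= n)%N -> const_triangular (munit K n i j).
Proof.
move=> /andP[ij jn]; exists 0 => k l lk; rewrite mxE mul0rn -!val_eqE /=.
rewrite !inordK //; last by apply: ltn_trans ij _.
case: eqP => //= ki; case: eqP => //= lj; by move: lk; rewrite ki lj leqNgt ij.
Qed.

(** Each strictly triangular factor raises the column index by at least 1. *)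
Lemma strict_prod m (a : 'I_m -> M) :
    (forall k (i j : 'I_n.+1), (j <= i)%N -> a k i j = 0) ->
  forall i j : 'I_n.+1, (j < i + m)%N -> (\prod_(k < m) a k) i j = 0.
Proof.
elim: m a => [|m IHm] a aE i j; first by rewrite addn0 big_ord0 mxE -val_eqE /= => /gtn_eqF ->.
move=> jim; rewrite big_ord_recl mxE big1 // => k _.
have [ki|ik] := leqP k i; first by rewrite aE // mul0r.
rewrite (IHm (fun l => a (lift ord0 l))) ?mulr0 //; first by move=> l; apply: aE.
by apply: leq_trans jim _; rewrite addnS -addSn leq_add2r.
Qed.

(** The scalar parts of the arguments may be removed one at a time, because a
    proper polynomial vanishes when an argument is 1; on strictly triangular
    matrices each monomial is a product of more than n factors. *)
Lemma proper_identity m (x : Ass K m) : (n < m)%N -> is_proper x ->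
  forall a : 'I_m -> M, (forall i, const_triangular (a i)) -> ev x a = 0.
Proof.
move=> nm xP a Sa.
have /choice[c cE] i : exists c, forall k l : 'I_n.+1, (l <= k)%N -> a i k l = c *+ (k == l).
  exact: Sa.
(* The scalar part is removed from the first k arguments. *)
pose b k (i : 'I_m) : M := if (i < k)%N then a i - (c i)%:A else a i.
have step k : (k <= m)%N -> ev x a = ev x (b k).
  elim: k => [_|k IHk km]; first by apply: eq_ev => i; rewrite /b ltn0.
  rewrite IHk 1?ltnW //; pose i0 := Ordinal km.
  pose b1 i := if i == i0 then 1 else b k i.
  rewrite (@ev_multilinear _ _ _ x i0 (b k) b1 (b k.+1) (b k) (c i0)).
  - by rewrite (xP _ _ i0) ?/b1 ?eqxx // scaler0 add0r.
  - by move=> j /negbTE; rewrite /b1 => ->.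
  - by move=> j jk; rewrite /b ltnS leq_eqVlt -[k]/(val i0) val_eqE (negbTE jk).
  - by [].
  - by rewrite /b1 eqxx /b ltnn ltnSn addrC subrK.
rewrite (step m) // /ev big1 // => s _.
rewrite [X in _ *: X](_ : _ = 0) ?scaler0 //; apply/matrixP => i j; rewrite [RHS]mxE.
apply: strict_prod => [k k1 k2 le|]; last by apply: leq_trans (ltn_ord j) (leq_trans nm (leq_addl _ _)).
by rewrite /b ltn_ord !mxE cE // mulr_natr subrr.
Qed.
End TriangularMatrices.

Section FiveByFive.
Variable K : fieldType.
Local Notation M := 'M[K]_5.
Local Notation E i j := (munit K 4 i j).

Definition shift : M := E 0 1 + E 1 2 + E 2 3 + E 3 4.

(** Polynomials in the shift, perturbed in the first row only.  The shift has
    zero first column, so that p(Z) E_00 = p(0) E_00, and the product rule is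
    (p + E v)(q + E w) = pq + E (p(0) w + v q) with E = E_00.  Up to the
    perturbation the algebra is commutative, and E v E w = 0. *)
Definition row_perturbation (a : M) : Prop :=
  exists (p : {poly K}) (v : M), a = horner_mx shift p + E 0 0 * v /\ E 0 0 * v * E 0 0 = 0.

Lemma munit_shift j : (j < 4)%N -> E 0 j * shift = E 0 j.+1.
Proof.
by case: j => [|[|[|[|//]]]] _; rewrite /shift !mulrDr !munitM //= ?add0r ?addr0.
Qed.

Lemma shift_munit j : shift * E 0 j = 0.
Proof. by rewrite /shift !mulrDl !munitM //= !addr0. Qed.

Lemma horner_munit (p : {poly K}) j : horner_mx shift p * E 0 j = p.[0] *: E 0 j.
Proof.
elim/poly_ind: p => [|p c IHp]; first by rewrite rmorph0 mul0r horner0 scale0r.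
rewrite hornerMXaddC mulr0 add0r rmorphD rmorphM /= horner_mx_X horner_mx_C mulrDl.
by rewrite -mulrA shift_munit mulr0 add0r -[_ * _]/(_ *m _) mul_scalar_mx.
Qed.

Lemma row_perturbation1 : row_perturbation 1.
Proof. by exists 1, 0; rewrite rmorph1 mulr0 addr0 mul0r. Qed.

Lemma row_perturbationZD c a b : row_perturbation a -> row_perturbation b ->
  row_perturbation (c *: a + b).
Proof.
move=> [p [v [-> vE]]] [q [w [-> wE]]]; exists (c *: p + q), (c *: v + w); split.
  rewrite rmorphD /= linearZ /= mulrDr -scalerAr scalerDr !addrA; congr (_ + _).
  by rewrite -!addrA; congr (_ + _); rewrite addrC.
by rewrite mulrDr mulrDl -scalerAr -scalerAl vE wE scaler0 addr0.
Qed.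

Lemma row_perturbation_mul (p q : {poly K}) (v w : M) : E 0 0 * v * E 0 0 = 0 ->
  (horner_mx shift p + E 0 0 * v) * (horner_mx shift q + E 0 0 * w) =
  horner_mx shift (p * q) + E 0 0 * (p.[0] *: w + v * horner_mx shift q).
Proof.
move=> vE; rewrite mulrDl !mulrDr rmorphM /= -addrA; congr (_ + _).
rewrite [horner_mx _ p * _]mulrA horner_munit [_ * (E 0 0 * w)]mulrA vE mul0r addr0.
by rewrite -scalerAl -scalerAr mulrA.
Qed.

Lemma row_perturbationM a b : row_perturbation a -> row_perturbation b ->
  row_perturbation (a * b).
Proof.
move=> [p [v [-> vE]]] [q [w [-> wE]]]; rewrite row_perturbation_mul //.
exists (p * q), (p.[0] *: w + v * horner_mx shift q); split=> //.
rewrite mulrDr mulrDl -scalerAr -scalerAl wE scaler0 add0r.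
by rewrite -!mulrA horner_munit -!scalerAr mulrA vE scaler0.
Qed.

Lemma row_perturbation_triangular a : row_perturbation a -> const_triangular a.
Proof.
have E_tri i j : (i < j <= 4)%N -> const_triangular (E i j) by exact: const_triangular_munit.
have Z_tri : const_triangular shift.
  have D x y : const_triangular x -> const_triangular y -> const_triangular (x + y : M).
    by move=> Sx Sy; rewrite -[x]scale1r; apply: const_triangularZD.
  by apply: (D _ _ (D _ _ (D _ _ _ _) _) _); apply: E_tri.
move=> [p [v [-> vE]]]; rewrite -[horner_mx _ _]scale1r; apply: const_triangularZD.
  elim/poly_ind: p => [|p c IHp].
    by rewrite rmorph0; exists 0 => i j _; rewrite mxE mul0rn.
  rewrite rmorphD rmorphM /= horner_mx_X horner_mx_C addrC -[c%:M]mulr1 -[_ * 1]/(_ *m _) mul_scalar_mx.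
  apply: const_triangularZD; first exact: const_triangular1.
  exact: const_triangularM.
exists 0 => i j ij; rewrite mul0rn.
have [i0|i0] := eqVneq i (inord 0); last first.
  rewrite mxE big1 // => k _; rewrite mxE (negbTE i0) mul0r //.
have -> : j = inord 0.
  by apply: val_inj; move: ij; rewrite i0 /= inordK // leqn0 => /eqP ->.
have := congr1 (fun A : M => A (inord 0) (inord 0)) vE; rewrite i0 [RHS]mxE => <-.
rewrite [RHS]mxE (bigD1 (inord 0)) //= [X in _ + X]big1 ?addr0 => [|k k0].
  by rewrite [X in _ = _ * X]mxE !eqxx mulr1.
by rewrite [X in _ * X]mxE (negbTE k0) mulr0.
Qed.

(** Commutators have the form E v with E v E = 0, so that the product of two of
    them vanishes. *)
Lemma row_perturbation_commutators a b a' b' : row_perturbation a -> row_perturbation b ->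
    row_perturbation a' -> row_perturbation b' ->
  (a * b - b * a) * (a' * b' - b' * a') = 0.
Proof.
have comm x y : row_perturbation x -> row_perturbation y ->
    exists v, x * y - y * x = E 0 0 * v /\ E 0 0 * v * E 0 0 = 0.
  move=> [p [v [-> vE]]] [q [w [-> wE]]]; rewrite !row_perturbation_mul // [q * p]mulrC.
  exists (p.[0] *: w + v * horner_mx shift q - (q.[0] *: v + w * horner_mx shift p)); split.
    by rewrite mulrBr opprD addrACA subrr add0r.
  rewrite mulrBr mulrBl !mulrDr !mulrDl -!scalerAr -!scalerAl vE wE !scaler0 !add0r.
  by rewrite -!mulrA !horner_munit -!scalerAr !mulrA vE wE !scaler0 subrr.
move=> ha hb ha' hb'; have [v [-> vE]] := comm _ _ ha hb; have [w [-> _]] := comm _ _ ha' hb'.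
by rewrite mulrA vE mul0r.
Qed.
End FiveByFive.

Section GKdimFive.
Variables (R : realType) (K : fieldType).
Local Notation E i j := (munit K 4 i j).

Lemma isomorphic_dim (P Q : operad K) n : operad_isomorphic P Q ->
  (\dim {: P n} <= \dim {: Q n})%N.
Proof.
move=> [f [fM fB]].
pose g : {linear P n -> Q n} := HB.pack (f n)
  (GRing.isLinear.Build K _ _ _ (f n) (@morphism_linear _ _ _ _ fM n)).
have gI : lker (linfun g) == 0%VS.
  by apply/lker0P => x y; rewrite !lfunE /=; apply: bij_inj.
by rewrite -(@limg_dim_eq _ _ _ (linfun g)) ?dimvS ?subvf // (eqP gI) capv0.
Qed.

(** The second ideal contains the first because the second algebra is a
    subalgebra of the first. *)
Lemma GKdim5_nonunique : exists J1 J2 : operad_ideal (Ass K),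
  [/\ GKdim R (quotient_operad J1) = 5%:E,
      GKdim R (quotient_operad J2) = 5%:E
    & ~ operad_isomorphic (quotient_operad J1) (quotient_operad J2)].
Proof.
have [J1 J1P] := identities_ideal (@const_triangular1 K 4)
  (@const_triangularZD K 4) (@const_triangularM K 4).
have [J2 J2P] := identities_ideal (@row_perturbation1 K)
  (@row_perturbationZD K) (@row_perturbationM K).
have J12 n : (J1 n <= J2 n)%VS.
  apply/subvP => x /J1P H; apply/J2P => a Sa; apply: H => i.
  exact: row_perturbation_triangular.
have [c2 [c3 [c4 [[c2P _ c4P] c2E c3E c4E _]]]] := iterated_commutators K.
have [h [hE _]] := juxtapose c2 c2.
have c4J : c4 \notin J2 4%N.
  apply/negP => /J2P H.
  (* Each commutator with the shift moves the matrix unit in the first row one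
     step to the right. *)
  pose b := nth 0 [:: E 0 1; shift K; shift K; shift K].
  have := munit_neq0 K 4 0 4; case/eqP; rewrite -(H (fun i => b i)).
    rewrite c4E c3E c2E /b /= munit_shift // shift_munit subr0 munit_shift // shift_munit subr0.
    by rewrite munit_shift // shift_munit subr0.
  have Sb : row_perturbation (E 0 1).
    by exists 0, (E 0 1); rewrite rmorph0 add0r !munitM.
  have Sz : row_perturbation (shift K).
    by exists 'X, 0; rewrite horner_mx_X mulr0 addr0 mul0r.
  by case=> -[|[|[|[|//]]]].
have GKdim5 (J : operad_ideal (Ass K)) : (forall n, (J1 n <= J n)%VS) ->
    c4 \notin J 4%N -> GKdim R (quotient_operad J) = 5%:E.
  move=> sJ cJ; apply/eqP; rewrite eq_le (GKdim_ge R c4P cJ) andbT.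
  apply: GKdim_le_proper => // m x m5 xP; apply: (subvP (sJ m)); apply/J1P => a Sa.
  exact: proper_identity.
exists J1, J2; split.
- by apply: GKdim5 => //; apply: contra c4J; apply/subvP.
- exact: GKdim5.
move=> iso; have := isomorphic_dim 4 iso; rewrite !dim_vquot leqNgt => /negP; apply.
(* The polynomial h is [x1,x2][x3,x4]. *)
have hJ2 : h \in J2 4%N.
  apply/J2P => a Sa; pose b k := if insub k is Some i then a i else 0.
  have ab : a =1 (fun i => b i) by move=> i; rewrite /b valK.
  rewrite (eq_ev h ab); apply: etrans (hE _ _) _.
  rewrite [ev c2 (_ \o lshift 2)]c2E [ev c2 (_ \o _)](c2E _ (fun k => b (2 + k)%N)).
  have Sb k : (k < 4)%N -> row_perturbation (b k) by move=> lt; rewrite /b insubT.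
  by apply: row_perturbation_commutators; apply: Sb.
have hJ1 : h \notin J1 4%N.
  apply/negP => /J1P H; pose b := nth 0 [:: E 0 1; E 1 2; E 2 3; E 3 4].
  have := munit_neq0 K 4 0 4; case/eqP; rewrite -(H (fun i => b i)).
    apply: esym; apply: etrans (hE _ _) _.
    rewrite [ev c2 (_ \o lshift 2)]c2E [ev c2 (_ \o _)](c2E _ (fun k => b (2 + k)%N)).
    by rewrite /b /= !munitM //= !subr0 munitM.
  by case=> -[|[|[|[|//]]]] /=; move=> *; apply: const_triangular_munit.
have lt12 : (\dim (J1 4%N) < \dim (J2 4%N))%N.
  rewrite ltn_neqAle dimvS // andbT; apply: contra hJ1 => /eqP e.
  suff -> : J1 4%N = J2 4%N by [].
  by apply/eqP; rewrite eqEdim J12 e leqnn.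
apply: (ltn_sub2l _ lt12); apply: leq_trans lt12 _.
by rewrite -dimvf dimvS // subvf.
Qed.
End GKdimFive.

(* The hypothesis 3 != 0 bears on the GKdim 4 clause only; that clause fails in
   characteristic 3, see the comment on Upsilon in Defs.v and NOTES.md. *)
Theorem theorem0p7 (K : fieldType) (R : realType) :
  (forall J : operad_ideal (Ass K),
    let P := quotient_operad J in
    [/\ GKdim R P = 1%:E ->
          (forall n, J n = Upsilon K 1 n) /\ operad_isomorphic P (Com K),
        GKdim R P <> 2%:E /\ ~ (1%:E < GKdim R P < 3%:E)%E,
        GKdim R P = 3%:E -> forall n, J n = Upsilon K 3 n
      & (3%:R != 0 :> K) ->
        GKdim R P = 4%:E -> forall n, J n = Upsilon K 4 n]) /\
  (exists J1 J2 : operad_ideal (Ass K),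
    [/\ GKdim R (quotient_operad J1) = 5%:E,
        GKdim R (quotient_operad J2) = 5%:E
      & ~ operad_isomorphic (quotient_operad J1) (quotient_operad J2)]).
Proof.
split=> [J P|]; last exact: GKdim5_nonunique.
split; first exact: GKdim1_Com.
- have gap := @GKdim_gap R K J; split=> // d2; apply: gap.
  by rewrite -/P d2 !lte_fin !(ltr_nat _ 1 2) (ltr_nat _ 2 3).
- exact: GKdim3_Upsilon.
- exact: GKdim4_Upsilon.
Qed.
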